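(* Assume Martin's Axiom together with $2^{\aleph_0}>\aleph_1$. If $A$ and $B$ are abelian groups of cardinality $\leq\aleph_1$ with $\operatorname{Ext}(A,\mathbb{Z})=0$ and $\operatorname{Ext}(B,\mathbb{Z})=0$, then $\operatorname{Ext}(A,B^{*})=0$, where $B^{*}=\operatorname{Hom}(B,\mathbb{Z})$.
   Context: All groups are abelian. Martin's Axiom (MA) states that for every c.c.c. partially ordered set $P$ and every family of fewer than $2^{\aleph_0}$ dense subsets of $P$, there is a directed subset of $P$ meeting each of them. *)

(* Defs.v *)
From HB Require Import structures.
From mathcomp Require Import all_boot all_order all_algebra.
From mathcomp Require Import boolp wochoice classical_sets functions cardinality.
From mathcomp Require Import freeg.

Set Implicit Arguments.
Unset Strict Implicit.
Unset Printing Implicit Defensive.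

Import Order.TTheory GRing.Theory.
Local Open Scope classical_set_scope.
Local Open Scope card_scope.
Local Open Scope ring_scope.

Definition card_lt (T U : Type) (X : set T) (Y : set U) : Prop :=
  X #<= Y /\ ~ (Y #<= X).

Definition continuum : set (set nat) := [set: set nat].

Definition order_iso (R S : rel nat) : Prop :=
  exists2 f : nat -> nat, bijective f & {mono f : m n / R m n >-> S m n}.

(* Cantor's second number class: the order types (as isomorphism classes) of
   the well-orderings of nat, i.e. the infinite countable ordinals. By
   definition aleph_1 is its cardinality. *)
Definition aleph1 : set (set (rel nat)) :=
  [set C | exists2 R : rel nat, well_order R & C = [set S | order_iso R S]].

(* Forcing posets are read upwards: extending a condition means going up. *)
Section Forcing.
Context {d : Order.disp_t} {P : porderType d}.
Implicit Types (S D G : set P) (p q r : P).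

Definition compatible p q : Prop := exists2 r, (p <= r)%O & (q <= r)%O.

Definition antichain S : Prop :=
  forall p q, S p -> S q -> p <> q -> ~ compatible p q.

Definition dense_in_poset D : Prop := forall p, exists2 q, D q & (p <= q)%O.

Definition directed G : Prop :=
  G !=set0 /\
  forall p q, G p -> G q -> exists r, [/\ G r, (p <= r)%O & (q <= r)%O].

End Forcing.

Definition ccc {d : Order.disp_t} (P : porderType d) : Prop :=
  forall S : set P, antichain S -> countable S.

(* The poset must be nonempty: the empty poset is c.c.c. and its empty subset
   is dense, but nothing meets the empty set. *)
Definition martin_axiom : Prop :=
  forall (d : Order.disp_t) (P : porderType d) (F : set (set P)),
    [set: P] !=set0 -> ccc P ->
    card_lt F continuum -> (forall D, F D -> dense_in_poset D) ->
    exists2 G : set P, directed G & forall D, F D -> G `&` D !=set0.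

(* Hom(U, V) is {additive U -> V} with pointwise operations. *)
Section Hom.
Variables U V : zmodType.
Implicit Types f g h : {additive U -> V}.

HB.instance Definition _ := gen_eqMixin {additive U -> V}.
HB.instance Definition _ := gen_choiceMixin {additive U -> V}.

Definition hom_zero : {additive U -> V} := \0.
Definition hom_opp f : {additive U -> V} := \- f.
Definition hom_add f g : {additive U -> V} := f \+ g.

Lemma homP f g : f =1 g -> f = g.
Proof.
case: f => f [[cf]]; case: g => g [[cg]] /= /funext eq_fg.
by rewrite -{}eq_fg in cg *; rewrite (Prop_irrelevance cf cg).
Qed.

Lemma hom_addA : associative hom_add.
Proof. by move=> f g h; apply: homP => x /=; rewrite addrA. Qed.

Lemma hom_addC : commutative hom_add.
Proof. by move=> f g; apply: homP => x /=; rewrite addrC. Qed.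

Lemma hom_add0 : left_id hom_zero hom_add.
Proof. by move=> f; apply: homP => x /=; rewrite add0r. Qed.

Lemma hom_addN : left_inverse hom_zero hom_opp hom_add.
Proof. by move=> f; apply: homP => x /=; rewrite addNr. Qed.

HB.instance Definition _ := GRing.isZmodule.Build {additive U -> V}
  hom_addA hom_addC hom_add0 hom_addN.

End Hom.

Definition dual_group (B : zmodType) : zmodType := {additive B -> int}.

(* Ext(A, C) is the first right derived functor of Hom(-, C), computed on the
   canonical free resolution 0 -> relations A -> {freeg A} -> A -> 0, that is,
   the cokernel of Hom({freeg A}, C) -> Hom(relations A, C). *)
Section Resolution.
Variable A : zmodType.

Definition augmentation : {freeg A} -> A :=
  fglift (fun a : A => (a : zmodule A)).

Fact augmentation_is_zmod_morphism : zmod_morphism augmentation.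
Proof.
move=> x y; exact: (@lift_is_additive int A (zmodule A) (fun a : A => a) x y).
Qed.

HB.instance Definition _ :=
  GRing.isZmodMorphism.Build {freeg A} A augmentation
    augmentation_is_zmod_morphism.

Definition relation_pred : {freeg A} -> bool := fun x => augmentation x == 0.

Fact relation_zmod_closed : zmod_closed relation_pred.
Proof.
split=> [|x y]; rewrite !unfold_in /relation_pred; first by rewrite raddf0.
by move=> /eqP x0 /eqP y0; rewrite raddfB /= x0 y0 subr0.
Qed.

HB.instance Definition _ :=
  GRing.isZmodClosed.Build {freeg A} relation_pred relation_zmod_closed.

Record relations := Relation {
  relation_val :> {freeg A};
  _ : relation_val \in relation_pred
}.

HB.instance Definition _ := [isSub for relation_val].
HB.instance Definition _ := [Choice of relations by <:].
HB.instance Definition _ := [SubChoice_isSubZmodule of relations by <:].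

End Resolution.

Section Ext.
Variables A C : zmodType.

Definition restrict_relations (f : {additive {freeg A} -> C}) :
  {additive relations A -> C} := f \o (val : relations A -> {freeg A}).

Definition restrictable : {additive relations A -> C} -> bool :=
  fun g => `[< exists f, g = restrict_relations f >].

Fact restrictable_zmod_closed : zmod_closed restrictable.
Proof.
split=> [|_ _ /asboolP[f ->] /asboolP[g ->]]; apply/asboolP.
  by exists 0; apply: homP.
by exists (f - g); apply: homP.
Qed.

HB.instance Definition _ :=
  GRing.isZmodClosed.Build {additive relations A -> C} restrictable
    restrictable_zmod_closed.

Definition Ext : zmodType :=
  Quotient.quot
    (GRing.ZmodClosed.clone {additive relations A -> C} restrictable _).

End Ext.

Definition trivial_group (G : zmodType) : Prop := forall x : G, x = 0.

(* Main.v *)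
(* Resolving Z by Q -> Q/Z, the hypothesis on A says that homomorphisms
   A -> Q/Z lift to Q, and the conclusion becomes: a map A x B -> Q that is
   biadditive modulo Z is congruent to a biadditive one. The latter is built by
   Martin's axiom from approximations on S x T, with S and T finitely generated
   pure subgroups of A and B.

   The countable chain condition holds because, for countable pure G in A, all
   but countably many members S of a suitable uncountable family have a finitely
   generated pure closure modulo G. Otherwise uncountably many S_x give infinite
   chains Y_n = p_n Y_{n+1} + w_n over G. Along such a chain a homomorphism to
   Q/Z may be prescribed by arbitrary binary digits c_x(n), whereas a lift to Q is
   determined by countably many parameters and the data (p_n, w_n) of the chain.
   A generic slalom allows the digits c_x to branch before the data of the chains
   do, and then two chains with the same parameters contradict each other.
   The same argument with all digit sequences on one chain shows that pure
   closures of finite sets in A are finitely generated. *)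

Require Import Defs.
From HB Require Import structures.
From mathcomp Require Import all_boot all_order all_algebra.
From mathcomp Require Import boolp classical_sets functions cardinality.
From mathcomp Require Import freeg zify.

Set Implicit Arguments.
Unset Strict Implicit.
Unset Printing Implicit Defensive.

Import Order.TTheory GRing.Theory Num.Theory.
Local Open Scope classical_set_scope.
Local Open Scope card_scope.
Local Open Scope ring_scope.

(** * Countable sets and Martin's axiom for preorders *)

(** Two chains contradict each other only if their data [p], [w] agree up to and including the place
    where their digits first differ. On a single chain this is automatic, but in a family the data
    of two chains may branch before freely chosen digits do; this is the obstacle that the slalom
    removes, its nodes being known before the data reach them. Digits cannot be prescribed on all
    chains of a family at once, since the chains may depend on one another. A maximal consistent
    subfamily is used instead; it is uncountable because only countably many chains depend on a
    given countable subgroup. One lift then serves uncountably many chains. Finite generation modulo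
    [G] is what amalgamation needs: it gives a condition a basis [r ++ z] with [r] inside [G] and
    [z] independent modulo [G]. Values of a biadditive map are free on pairs of basis elements, so a
    condition with basis inside [G] that extends [r] can disagree with it only on the pairs from the
    two roots. Bases are not canonical, so the root is not found by a Delta-system argument but by
    reflecting a condition into a countable closed set. *)

Lemma countable_image T U (f : T -> U) (S : set T) :
  countable S -> countable (f @` S).
Proof. exact/card_le_trans/card_image_le. Qed.

Lemma countable_sub T (S S' : set T) : S `<=` S' -> countable S' -> countable S.
Proof. by move=> /subset_card_le /sub_countable. Qed.

Lemma countableU T (S S' : set T) :
  countable S -> countable S' -> countable (S `|` S').
Proof.
move=> cS cS'; have -> : S `|` S' = \bigcup_(b in [set: bool]) if b then S else S'.
  apply/seteqP; split=> x /=; first by case=> ?; [exists true|exists false].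
  by case=> -[] _; [left|right].
by apply: bigcup_countable => // -[].
Qed.

Lemma uncountable_fiber T U (S : set T) (f : T -> U) :
  ~ countable S -> countable (f @` S) ->
  exists u, ~ countable [set x | S x /\ f x = u].
Proof.
move=> ncS cf; apply: contrapT => cF; apply: ncS.
have -> : S = \bigcup_(u in f @` S) [set x | S x /\ f x = u].
  apply/seteqP; split=> x; last by case=> u _ [].
  by move=> Sx; exists (f x) => //; exists x.
by apply: bigcup_countable => // u _; apply: contrapT => ncu; apply: cF; exists u.
Qed.

Lemma uncountable_fiber_countType T (U : countType) (S : set T) (f : T -> U) :
  ~ countable S -> exists u, ~ countable [set x | S x /\ f x = u].
Proof. by move=> ncS; apply: uncountable_fiber => //; apply: countableP. Qed.

Lemma uncountable_setD T (S S' : set T) :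
  ~ countable S -> countable S' -> exists x, S x /\ ~ S' x.
Proof.
move=> ncS cS'; apply: contrapT => SS'; apply: ncS.
by apply: countable_sub cS' => x Sx; apply: contrapT => nS'x; apply: SS'; exists x.
Qed.

Lemma uncountable_pair T (S : set T) :
  ~ countable S -> exists x y, [/\ S x, S y & x <> y].
Proof.
move=> ncS; have [x [Sx _]] := uncountable_setD ncS (@countable0 T).
have [y [Sy xy]] := uncountable_setD ncS (countable1 x).
by exists x, y; split=> // /esym.
Qed.

Lemma countable_seqs (T : eqType) (C : set T) :
  countable C -> countable [set s : seq T | {in s, forall x, C x}].
Proof.
move=> /pcard_injP[f injf]; apply/pcard_injP.
exists (fun s => choice.pickle (map f s)) => s t; rewrite !inE /= => Cs Ct.
move=> /(pcan_inj (@choice.pickleK _)) Est.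
elim: s t Cs Ct Est => [|x s IHs] [|y t] //= Cs Ct [fxy Est].
rewrite (injf x y) //; do ?[exact/mem_set/Cs/mem_head|exact/mem_set/Ct/mem_head].
by rewrite (IHs t) // => z zs; [apply: Cs|apply: Ct]; rewrite inE zs orbT.
Qed.

Lemma card_le_setTP (T U : Type) :
  [set: T] #<= [set: U] <-> exists f : T -> U, injective f.
Proof.
elim/Ppointed: U => U; last first.
  split=> [/pcard_injP[f injf]|[f injf]].
    by exists f => x y; apply: injf; rewrite inE.
  by apply/pcard_injP; exists f => x y _ _; apply: injf.
rewrite emptyE; split=> [/eqP T0|[f _]].
  have T0' (x : T) : False by have : [set: T] x by []; rewrite T0.
  by exists (fun x => False_rect _ (T0' x)) => x; case: (T0' x).
by apply/eqP; rewrite -subset0 => x _; case: (no (f x)).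
Qed.

Lemma card_lt_continuumP (T : Type) :
  card_lt [set: T] continuum <->
  (exists f : T -> set nat, injective f) /\
  (forall f : set nat -> T, ~ injective f).
Proof.
rewrite /card_lt /continuum !card_le_setTP.
by split=> -[? H]; split=> //; [move=> f /(ex_intro _ f) /H|case=> f /H].
Qed.

Lemma card_lt_continuum_nat : card_lt [set: nat] continuum.
Proof.
apply/card_lt_continuumP; split=> [|f injf].
  exists (@set1 nat) => x y xy.
  by have : [set y] x by rewrite -xy.
pose D := [set n | exists2 X, n = f X & ~ X n].
have [Df|nDf] := pselect (D (f D)).
  by case: (Df) => X /injf <-.
by apply: (nDf); exists D.
Qed.

(** Bounds the number of dense sets in the two forcings, which are indexed by [A + nat] and [A + B].
    An injection of pairs of sets of naturals into [T + U] either sends a whole row into [T], or has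
    in every row a point sent to [U]; choosing such points gives an injection into [U]. *)
Lemma card_lt_continuum_sum (T U : Type) :
  card_lt [set: T] continuum -> card_lt [set: U] continuum ->
  card_lt [set: T + U] continuum.
Proof.
move=> /card_lt_continuumP[[f injf] Tlt] /card_lt_continuumP[[g injg] Ult].
pose pr (X Y : set nat) := [set n | if odd n then X n./2 else Y n./2].
have prl X Y X' Y' : pr X Y = pr X' Y' -> X = X'.
  move=> E; apply/funext => n; move: (congr1 (@^~ n.*2.+1) E).
  by rewrite /pr /mkset /= odd_double /= uphalf_double.
have prr X Y X' Y' : pr X Y = pr X' Y' -> Y = Y'.
  move=> E; apply/funext => n; move: (congr1 (@^~ n.*2) E).
  by rewrite /pr /mkset /= odd_double /= doubleK.
apply/card_lt_continuumP; split.
  exists (fun x => match x with inl t => pr setT (f t) | inr u => pr set0 (g u) end).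
  have T0 : [set: nat] <> set0.
    by move=> T0; have : [set: nat] 0%N by []; rewrite T0.
  case=> x [y|y] E.
  - by rewrite (injf _ _ (prr _ _ _ _ E)).
  - by case: T0; apply: prl E.
  - by case: T0; apply/esym; apply: prl E.
  - by rewrite (injg _ _ (prr _ _ _ _ E)).
move=> h injh.
have [[X hX]|] := pselect (exists X, forall Y, exists t, h (pr X Y) = inl t).
  have [k hk] := choice hX; apply: (Tlt k) => Y Y' E.
  by apply: (prr X Y X Y'); apply: injh; rewrite !hk E.
move=> /forallNP hX.
have {}hX X : exists Yu : set nat * U, h (pr X Yu.1) = inr Yu.2.
  have /existsNP[Y hY] := hX X.
  case E : (h (pr X Y)) => [t|u]; first by case: hY; exists t.
  by exists (Y, u).
have [k hk] := choice hX; apply: (Ult (fun X => (k X).2)) => X X' /= E.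
by apply: (prl _ (k X).1 _ (k X').1); apply: injh; rewrite !hk E.
Qed.

Section Preorder.
Variables (P : Type) (le : P -> P -> Prop).

Definition staged : Type := P * nat.

Definition staged_le (x y : staged) : bool :=
  `[< x = y \/ le x.1 y.1 /\ (x.2 < y.2)%N >].

Hypothesis le_trans : forall x y z, le x y -> le y z -> le x z.

Fact staged_le_refl : reflexive staged_le.
Proof. by move=> x; apply/asboolP; left. Qed.

Fact staged_le_anti : antisymmetric staged_le.
Proof.
move=> x y /andP[/asboolP[->//|[_ xy]] /asboolP[->//|[_ yx]]].
by move: (ltn_trans xy yx); rewrite ltnn.
Qed.

Fact staged_le_trans : transitive staged_le.
Proof.
move=> y x z /asboolP[->//|[xy xy2]] /asboolP[<-|[yz yz2]]; apply/asboolP; right.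
  by [].
by split; [apply: le_trans yz|apply: ltn_trans yz2].
Qed.

End Preorder.

(* The poset of Martin's axiom is obtained from a preorder by pairing each
   condition with a natural number that has to grow strictly. *)
Lemma martin_axiom_preorder (P : Type) (le : P -> P -> Prop) (I : Type)
    (D : I -> set P) :
  martin_axiom -> (exists p : P, True) ->
  (forall p, le p p) -> (forall p q r, le p q -> le q r -> le p r) ->
  (forall S : set P, ~ countable S ->
     exists p q r, [/\ S p, S q, p <> q, le p r & le q r]) ->
  card_lt [set: I] continuum ->
  (forall i p, exists2 q, D i q & le p q) ->
  exists G : set P,
    (forall p q, G p -> G q -> exists r, [/\ G r, le p r & le q r]) /\
    (forall i, exists2 p, G p & D i p).
Proof.
move=> MA [p0 _] le_refl le_trans cccP [leI ltI] denseD.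
pose T : choiceType := HB.pack (staged P) (gen_eqMixin (staged P))
  (gen_choiceMixin (staged P)).
pose d : Order.disp_t := Order.Disp tt tt.
pose mx := Order.Le_isPOrder.Build d T (staged_le_refl le)
   (@staged_le_anti _ le) (staged_le_trans le_trans).
pose Q : porderType d := HB.pack T mx.
have leQ (x y : Q) : (x <= y)%O = staged_le le x y by [].
pose E i : set Q := [set x : Q | D i x.1].
have [||||G [_ dirG] Gmeet] := MA d Q (range E).
- by exists ((p0, 0%N) : staged P).
- move=> S aS; apply: contrapT => ncS.
  (* With one stage [n] for uncountably many members, a common upper bound may be given stage
     [n.+1]. *)
  have [n ncn] := uncountable_fiber_countType (fun x : Q => (x : staged P).2) ncS.
  pose S' := (fun x : staged P => x.1) @` [set x : Q | S x /\ (x : staged P).2 = n].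
  have [cS'|ncS'] := pselect (countable S').
    have [p ncp] := uncountable_fiber ncn cS'.
    have [[x1 x2] [[y1 y2] [/= [[_ ?] ?] [[_ ?] ?] xy]]] := uncountable_pair ncp.
    by apply: xy; congr (_, _); subst.
  have [p [q [r [[x [Sx xn] xp] [y [Sy yn] yq] pq pr qr]]]] := cccP _ ncS'.
  apply: (aS x y Sx Sy); first by move=> xy; apply: pq; rewrite -xp -yq xy.
  exists ((r, n.+1) : staged P); rewrite leQ; apply/asboolP; right => /=.
    by split; [rewrite xp|rewrite xn].
  by split; [rewrite yq|rewrite yn].
- split; first exact: card_le_trans (card_image_le _ _) leI.
  by move=> /card_le_trans h; apply: ltI; apply: h; apply: card_image_le.
- move=> _ [i _ <-] [p n]; have [q Dq pq] := denseD i p.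
  by exists ((q, n.+1) : staged P); rewrite // leQ; apply/asboolP; right.
exists [set p | exists n, G (p, n)]; split=> [p q [n Gp] [m Gq]|i].
  have [[r k] [Gr pr qr]] := dirG _ _ Gp Gq.
  exists r; split; first by exists k.
    by move: pr; rewrite leQ => /asboolP[[->]|[]].
  by move: qr; rewrite leQ => /asboolP[[->]|[]].
have [|[p n] [Gp Ep]] := Gmeet (E i); first by exists i.
by exists p => //; exists n.
Qed.

(** * Divisible groups and pure subgroups *)

Section Subgroup.
Variable M : zmodType.
Implicit Types (S : set M) (x y : M).

Definition subgroup S : Prop := S 0 /\ forall x y, S x -> S y -> S (x - y).

Lemma subgroupN S x : subgroup S -> S x -> S (- x).
Proof. by case=> S0 SB Sx; rewrite -sub0r; apply: SB. Qed.

Lemma subgroupD S x y : subgroup S -> S x -> S y -> S (x + y).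
Proof. by move=> gS Sx Sy; rewrite -[y]opprK; apply: gS.2 => //; apply: subgroupN. Qed.

Lemma subgroupMz S x (k : int) : subgroup S -> S x -> S (x *~ k).
Proof.
move=> gS Sx; have SMn n : S (x *+ n).
  by elim: n => [|n IHn]; rewrite ?mulr0n ?mulrS; [case: gS|apply: subgroupD].
by case: k => n; [rewrite -pmulrn|rewrite NegzE mulrNz -pmulrn; apply: subgroupN].
Qed.

Lemma subgroup_sum S n (F : nat -> M) :
  subgroup S -> (forall i, (i < n)%N -> S (F i)) -> S (\sum_(i < n) F i).
Proof.
move=> gS SF; elim: n SF => [|n IHn] SF; first by rewrite big_ord0; case: gS.
rewrite big_ord_recr; apply: subgroupD => //; last exact: SF.
by apply: IHn => i lti; apply: SF; apply: ltnW.
Qed.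

End Subgroup.

Lemma pair_mulrz (M D : zmodType) (x : M) (y : D) (k : int) :
  (x, y) *~ k = (x *~ k, y *~ k).
Proof. by rewrite [LHS]surjective_pairing !raddfMz. Qed.

Lemma int_ideal (I : set int) :
  subgroup I -> exists2 k, I k & forall j, I j -> (k %| j)%Z.
Proof.
move=> gI; have [ex|nex] := pselect (exists n, (0 < n)%N && `[< I n%:Z >]); last first.
  exists 0 => [|j Ij]; first by case: gI.
  rewrite dvd0z; apply: contrapT => /negP j0; apply: nex; exists `|j|%N.
  rewrite absz_gt0 j0 /=; apply/asboolP; have [jge|jlt] := leP 0 j.
    by have -> : `|j|%N%:Z = j by lia.
  have -> : `|j|%N%:Z = - j by lia.
  exact: subgroupN.
case: (ex_minnP ex) => k /andP[k0 /asboolP Ik] kmin; exists k%:Z => // j Ij.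
apply/dvdzP; exists (j %/ k%:Z)%Z; rewrite {1}(divz_eq j k) -[RHS]addr0; congr (_ + _).
have kn0 : k%:Z != 0 by rewrite eqz_nat -lt0n.
have Im : I (j %% k)%Z.
  have -> : (j %% k)%Z = j - k%:Z *~ (j %/ k)%Z.
    by rewrite mulrzz mulrC {2}(divz_eq j k) addrC addKr.
  by apply: gI.2 => //; apply: subgroupMz.
have m0 := modz_ge0 j kn0; have mlt := ltz_pmod j (k0 : 0 < k%:Z).
apply/eqP/negPn/negP => mn0.
have := kmin `|(j %% k)%Z|%N; rewrite absz_gt0 mn0 /=.
have E : `|(j %% k)%Z|%N%:Z = (j %% k)%Z by lia.
rewrite E (asboolT Im) => /(_ isT); lia.
Qed.

Definition divisible (D : zmodType) : Prop :=
  forall (d : D) (k : int), k != 0 -> exists e, e *~ k = d.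

Lemma divisible_rat : divisible rat.
Proof.
move=> d k k0; exists (d / k%:~R).
by rewrite -mulrzr divfK // intr_eq0.
Qed.

(* Baer's criterion for multivalued homomorphisms: the subgroup [[set d | gam
   (0, d)]] is the indeterminacy, so this covers maps into quotients of [D]. *)
Lemma divisible_extension (M D : zmodType) (gam0 : set (M * D)) :
  divisible D -> subgroup gam0 ->
  exists gam : set (M * D), [/\ subgroup gam, gam0 `<=` gam,
    forall d, gam (0, d) -> gam0 (0, d) & forall m, exists d, gam (m, d)].
Proof.
move=> divD g0.
(* The union with [gam0] makes the empty set admissible, as Zorn's lemma also treats the empty
   chain. *)
pose P g := subgroup (g `|` gam0) /\ forall d, (g `|` gam0) (0, d) -> gam0 (0, d).
have [|gam1 [[g1 z1] max1]] := @Zorn_bigcup _ P.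
  move=> F FP totF.
  have chain x y : (\bigcup_(X in F) X `|` gam0) x -> (\bigcup_(X in F) X `|` gam0) y ->
     (gam0 x /\ gam0 y) \/ exists X, [/\ F X, (X `|` gam0) x & (X `|` gam0) y].
    case=> [[X FX Xx]|x0] [[Y FY Yy]|y0]; last by left.
    - have [XY|YX] := totF _ _ FX FY; right; [exists Y|exists X]; split=> //.
      + by left; apply: XY.
      + by left.
      + by left.
      + by left; apply: YX.
    - by right; exists X; split=> //; [left|right].
    - by right; exists Y; split=> //; [right|left].
  split; last first.
    by move=> d [[X FX Xd]|//]; apply: (FP X FX).2; left.
  split; first by right; case: g0.
  move=> x y /chain/[apply][] [[x0 y0]|[X [FX Xx Xy]]].
    by right; apply: g0.2.
  by case: ((FP X FX).1.2 _ _ Xx Xy) => Xxy; [left; exists X|right].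
exists (gam1 `|` gam0); split=> //.
set gam := gam1 `|` gam0 in g1 z1 *; move=> m.
pose I := [set j | exists d, gam (m *~ j, d)].
have [|k [d0 Ik] kI] := @int_ideal I.
  split; first by exists 0; rewrite mulr0z; case: g1.
  move=> i j [d Id] [e Ie]; exists (d - e).
  by rewrite mulrzBr; apply: (g1.2 (_, _) (_, _)).
(* The multiples of [m] already in the domain are those of [m *~ k], so the value at [m] only has to
   be a [k]-th part of a given value; for [k = 0] any value will do. *)
have [e ke] : exists e, gam (m *~ k, e *~ k).
  have [->|k0] := eqVneq k 0; first by exists 0; rewrite !mulr0z; case: g1.
  by have [e Ee] := divD d0 k k0; exists e; rewrite Ee.
pose gam2 := [set p : M * D | exists x j, gam x /\ p = (x.1 + m *~ j, x.2 + e *~ j)].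
have sub12 : gam `<=` gam2.
  by move=> [x y] gx; exists (x, y), 0; rewrite !mulr0z !addr0.
have gam2m : gam2 (m, e).
  by exists 0, 1; split; [case: g1|rewrite !mulr1z !add0r].
have P2 : P gam2.
  rewrite /P; have -> : gam2 `|` gam0 = gam2.
    by apply/seteqP; split=> x; [case=> // x0; apply: sub12; right|left].
  (* No new indeterminacy arises: such a [j] is a multiple of [k], hence the multiple of [(m, e)] by
     [j] is already in [gam]. *)
  have E0 x j : gam x -> x.1 + m *~ j = 0 -> gam (0, x.2 + e *~ j).
    move=> gx E.
    case: x gx E => x1 x2 /= gx /eqP; rewrite addr_eq0 => /eqP Ex.
    have /kI/dvdzP[i ji] : I j.
      exists (- x2); have : gam (- x1, - x2) := subgroupN g1 gx.
      by rewrite Ex opprK.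
    have := subgroupMz i g1 ke.
    rewrite pair_mulrz -!mulrzA mulrC -ji => gji.
    have : gam (x1 + m *~ j, x2 + e *~ j) := subgroupD g1 gx gji.
    by rewrite Ex addNr.
  split; last by move=> d [x [j [gx [E ->]]]]; apply/z1/E0.
  split; first by apply: sub12; case: g1.
  move=> _ _ [x [i [gx ->]]] [y [j [gy ->]]]; exists (x - y), (i - j); split.
    exact: g1.2.
  by rewrite !mulrzBr; congr (_, _) => /=; rewrite opprD addrACA.
have [sub21|nsub] := pselect (gam2 `<=` gam1); first by exists e; left; apply: sub21.
case: (max1 gam2) => //; split=> // x x1; apply: sub12; by left.
Qed.

Lemma exists_additive (M D : zmodType) (f : M -> D) :
  (forall x y, f (x - y) = f x - f y) -> exists g : {additive M -> D}, g =1 f.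
Proof.
move=> fB; pose mf := GRing.isZmodMorphism.Build M D f fB.
by exists (HB.pack f mf : {additive M -> D}).
Qed.

Lemma additive_extension (M D : zmodType) (gam : set (M * D)) :
  divisible D -> subgroup gam -> (forall d, gam (0, d) -> d = 0) ->
  exists f : {additive M -> D}, forall m d, gam (m, d) -> f m = d.
Proof.
move=> divD g0 z0; have [g [gg subg zg totg]] := divisible_extension divD g0.
have [f fP] := choice totg.
have uniq m d : g (m, d) -> f m = d.
  move=> gmd; have : g (m - m, f m - d) := gg.2 _ _ (fP m) gmd.
  by rewrite subrr => /zg/z0/eqP; rewrite subr_eq0 => /eqP.
have [x y|f' f'E] := @exists_additive _ _ f.
  by apply/uniq; apply: (gg.2 (x, f x) (y, f y)).
by exists f' => m d /subg/uniq; rewrite f'E.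
Qed.

(* The Whitehead property [Ext(A, Z) = 0], phrased through the injective
   resolution [0 -> Z -> Q -> Q/Z -> 0]: homomorphisms into [Q/Z], given here by
   representatives in [Q], lift to [Q]. *)
Definition lifting (A : zmodType) : Prop :=
  forall h : A -> rat, (forall x y, h (x + y) - h x - h y \is a Num.int) ->
  exists f : {additive A -> rat}, forall x, f x - h x \is a Num.int.

(** Here [gam] is the graph of a homomorphism from a subgroup of [A] to Q/Z. Divisibility extends it
    to all of [A] with the same indeterminacy, and the extension lifts. *)
Lemma lifting_graph (A : zmodType) (gam : set (A * rat)) :
  lifting A -> subgroup gam -> (forall q, gam (0, q) -> q \is a Num.int) ->
  exists f : {additive A -> rat}, forall a q, gam (a, q) -> f a - q \is a Num.int.
Proof.
move=> LA g0 z0; have [g [gg subg zg totg]] := divisible_extension divisible_rat g0.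
have [h hP] := choice totg.
have uniq m d d' : g (m, d) -> g (m, d') -> d - d' \is a Num.int.
  move=> gm gm'; have : g (m - m, d - d') := gg.2 _ _ gm gm'.
  by rewrite subrr => /zg/z0.
have [x y|f fh] := LA h.
  rewrite -addrA -opprD; apply: (uniq (x + y)) => //.
  exact: (subgroupD gg (hP x) (hP y)).
exists f => a q /subg/(uniq _ _ _ (hP a)) hq.
by have := rpredD (fh a) hq; rewrite addrA subrK.
Qed.

(** * Integer combinations, purity and independence modulo a subgroup *)

Section LinearCombinations.
Variable A : zmodType.
Implicit Types (e z u l : seq A) (n m : nat -> int) (W G : set A) (x a : A).

Definition lincomb e n : A := \sum_(i < size e) e`_i *~ n i.

Lemma lincombB e n m : lincomb e (fun i => n i - m i) = lincomb e n - lincomb e m.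
Proof.
rewrite /lincomb -sumrB; by apply: eq_bigr => i _; rewrite mulrzBr.
Qed.

Lemma lincombM e n (k : int) : lincomb e (fun i => n i * k) = lincomb e n *~ k.
Proof. by rewrite /lincomb mulrz_suml; apply: eq_bigr => i _; rewrite mulrzA. Qed.

Lemma eq_lincomb e n m :
  (forall i, (i < size e)%N -> n i = m i) -> lincomb e n = lincomb e m.
Proof. by move=> nm; apply: eq_bigr => i _; rewrite nm. Qed.

Lemma lincomb0 e : lincomb e (fun=> 0) = 0.
Proof. by apply: big1 => i _; rewrite mulr0z. Qed.

Lemma lincomb1 a n : lincomb [:: a] n = a *~ n 0%N.
Proof. by rewrite /lincomb big_ord_recl big_ord0 addr0. Qed.

Lemma lincomb_delta e i :
  (i < size e)%N -> lincomb e (fun j => (i == j)%:Z) = e`_i.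
Proof.
move=> lti; rewrite /lincomb (bigD1 (Ordinal lti)) //= eqxx big1 ?addr0 // => j.
by rewrite -val_eqE /= eq_sym => /negPf ->; rewrite mulr0z.
Qed.

Lemma lincomb_cat e z n :
  lincomb (e ++ z) n = lincomb e n + lincomb z (fun i => n (size e + i)%N).
Proof.
rewrite /lincomb size_cat big_split_ord /=; congr (_ + _); apply: eq_bigr => i _.
  by rewrite nth_cat ltn_ord.
by rewrite nth_cat ltnNge leq_addr addKn.
Qed.

Lemma raddf_lincomb (D : zmodType) (f : {additive A -> D}) e n :
  f (lincomb e n) = \sum_(i < size e) f e`_i *~ n i.
Proof. by rewrite raddf_sum; apply: eq_bigr => i _; rewrite raddfMz. Qed.

Lemma subgroup_lincomb W e n :
  subgroup W -> {in e, forall x, W x} -> W (lincomb e n).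
Proof.
move=> gW We; apply: (@subgroup_sum _ W (size e) (fun i => e`_i *~ n i)) => // i lti.
by apply: subgroupMz => //; apply/We/mem_nth.
Qed.

Definition spanned G e : set A := [set a | exists n, G (a - lincomb e n)].

Definition int_span e : set A := spanned [set 0] e.

Lemma subgroup_set0 : subgroup [set 0 : A].
Proof. by split=> // x y -> ->; rewrite subr0. Qed.

Lemma int_spanP e a : int_span e a <-> exists n, a = lincomb e n.
Proof.
split=> -[n]; first by move/eqP; rewrite subr_eq0 => /eqP ->; exists n.
by move=> ->; exists n; rewrite /= subrr.
Qed.

Lemma subgroup_spanned G e : subgroup G -> subgroup (spanned G e).
Proof.
move=> gG; split=> [|x y [n Gx] [m Gy]].
  by exists (fun=> 0); rewrite lincomb0 subr0; case: gG.
exists (fun i => n i - m i); rewrite lincombB.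
by have := gG.2 _ _ Gx Gy; rewrite !opprD !opprK addrACA.
Qed.

Lemma subgroup_int_span e : subgroup (int_span e).
Proof. exact/subgroup_spanned/subgroup_set0. Qed.

Lemma sub_spanned G e : G `<=` spanned G e.
Proof. by move=> x Gx; exists (fun=> 0); rewrite lincomb0 subr0. Qed.

Lemma mem_spanned G e x : subgroup G -> x \in e -> spanned G e x.
Proof.
move=> gG /(nthP 0)[i lti <-]; exists (fun j => (i == j)%:Z).
by rewrite lincomb_delta // subrr; case: gG.
Qed.

Lemma mem_int_span e x : x \in e -> int_span e x.
Proof. exact/mem_spanned/subgroup_set0. Qed.

Lemma spanned_min W G e :
  subgroup W -> G `<=` W -> {in e, forall x, W x} -> spanned G e `<=` W.
Proof.
move=> gW GW eW x [n /GW Wx]; rewrite -[x](subrK (lincomb e n)).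
by apply: subgroupD => //; apply: subgroup_lincomb.
Qed.

Lemma int_span_min W e : subgroup W -> {in e, forall x, W x} -> int_span e `<=` W.
Proof. by move=> gW; apply: spanned_min => // _ ->; case: gW. Qed.

Lemma int_span_cat e z : int_span e `<=` int_span (e ++ z).
Proof.
apply: int_span_min (subgroup_int_span _) _ => x xe.
by apply: mem_int_span; rewrite mem_cat xe.
Qed.

Lemma spanned_cat G e z :
  subgroup G -> spanned G (e ++ z) = spanned (spanned G e) z.
Proof.
move=> gG; apply/seteqP; split.
  apply: spanned_min.
  - exact/subgroup_spanned/subgroup_spanned.
  - by apply: subset_trans (@sub_spanned _ _); apply: sub_spanned.
  - move=> x; rewrite mem_cat => /orP[xe|xz]; first exact/sub_spanned/mem_spanned.
    exact/mem_spanned/xz/subgroup_spanned.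
apply: spanned_min; first exact: subgroup_spanned.
  apply: spanned_min; [exact: subgroup_spanned|exact: sub_spanned|].
  by move=> x xe; apply: mem_spanned; rewrite // mem_cat xe.
by move=> x xz; apply: mem_spanned; rewrite // mem_cat xz orbT.
Qed.

Definition pure W : Prop := forall x (d : int), d != 0 -> W (x *~ d) -> W x.

(* Independence modulo [G], with [spanned G e] moreover pure modulo [G]; the
   case [d = 0] is linear independence. *)
Definition pure_indep G e : Prop := forall n (d : int) x,
  G (x *~ d - lincomb e n) -> forall i, (i < size e)%N -> (d %| n i)%Z.

Lemma pure_indep_nil G : pure_indep G [::].
Proof. by []. Qed.

Lemma pure_indep_sub G G' e : G' `<=` G -> pure_indep G e -> pure_indep G' e.
Proof. by move=> sG ie n d x /sG/ie. Qed.

Lemma pure_indep_free G e n : subgroup G -> pure_indep G e -> G (lincomb e n) ->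
  forall i, (i < size e)%N -> n i = 0.
Proof.
move=> gG ie Gn i lti; apply/eqP; rewrite -dvd0z; apply: (ie n 0 0) => //.
by rewrite mulr0z sub0r; apply: subgroupN.
Qed.

Lemma dvd_lincomb e n (d : int) : (forall i, (i < size e)%N -> (d %| n i)%Z) ->
  exists m, lincomb e n = lincomb e m *~ d.
Proof.
move=> dn; exists (fun i => n i %/ d)%Z; rewrite -lincombM; apply: eq_lincomb => i lti.
by rewrite divzK ?dn.
Qed.

Lemma pure_indep_cat G e z : subgroup G ->
  pure_indep G e -> pure_indep (spanned G e) z -> pure_indep G (e ++ z).
Proof.
move=> gG ie iz n d x; rewrite lincomb_cat opprD => Gx.
have dz : forall i, (i < size z)%N -> (d %| n (size e + i))%Z.
  by apply: (iz _ _ x); exists n; rewrite addrAC -addrA.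
have [m E] := dvd_lincomb dz.
have de : forall i, (i < size e)%N -> (d %| n i)%Z.
  by apply: (ie _ _ (x - lincomb z m)); rewrite mulrzBl -E addrAC -addrA.
move=> i; rewrite size_cat => lti; have [/de//|lei] := ltnP i (size e).
by rewrite -(subnKC lei); apply: dz; rewrite ltn_subLR.
Qed.

Lemma pure_spanned G e : subgroup G -> pure G -> pure_indep G e ->
  pure (spanned G e).
Proof.
move=> gG pG ie x d d0 [n Gx]; have [m E] := dvd_lincomb (ie _ _ _ Gx).
by exists m; apply: (pG _ d d0); rewrite mulrzBl -E.
Qed.

Definition hull W : set A := [set x | exists2 d : int, d != 0 & W (x *~ d)].

Lemma sub_hull W : W `<=` hull W.
Proof. by move=> x Wx; exists 1. Qed.

Lemma hullS W W' : W `<=` W' -> hull W `<=` hull W'.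
Proof. by move=> WW' x [d d0 /WW']; exists d. Qed.

Lemma pure_hull W : pure (hull W).
Proof.
move=> x d d0 [k k0]; rewrite -mulrzA => Wx; exists (d * k) => //.
by rewrite mulf_neq0.
Qed.

Lemma hull_min W W' : W `<=` W' -> pure W' -> hull W `<=` W'.
Proof. by move=> WW' pW' x [d d0 /WW'/pW']; apply. Qed.

Lemma subgroup_hull W : subgroup W -> subgroup (hull W).
Proof.
move=> gW; split; first by apply: sub_hull; case: gW.
move=> x y [d d0 Wx] [k k0 Wy]; exists (d * k); first by rewrite mulf_neq0.
rewrite mulrzBl; apply: gW.2; first by rewrite mulrzA; apply: subgroupMz.
by rewrite mulrC mulrzA; apply: subgroupMz.
Qed.

(* [Y] witnesses that the pure closure of [W] and [a] is not finitely generated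
   over [W]. *)
Definition runaway W a (p : nat -> int) (w Y : nat -> A) : Prop :=
  [/\ Y 0%N = a, forall k, W (a *~ k) -> k = 0, forall i, W (w i),
      forall i, 1 < `|p i| & forall i, Y i = Y i.+1 *~ p i + w i].

(** If no pure generator [a'] exists, then every [y] whose span over [W] contains [a] fails to be
    pure modulo [W] and can be replaced by a [y'] of which it is a proper multiple modulo [W].
    Iterating from [a] gives the runaway chain. *)
Lemma pure_step W a : subgroup W -> pure W ->
  [\/ W a,
      exists a', [/\ pure_indep W [:: a'], spanned W [:: a'] a &
                     hull (spanned W [:: a]) a']
    | exists p w Y, runaway W a p w Y].
Proof.
move=> gW pW; have [Wa|nWa] := pselect (W a); first by apply: Or31.
have indep k : W (a *~ k) -> k = 0.
  by have [->//|k0] := eqVneq k 0 => /(pW _ _ k0).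
have [ex|nex] := pselect (exists a', [/\ pure_indep W [:: a'],
   spanned W [:: a'] a & hull (spanned W [:: a]) a']); first by apply: Or32.
apply: Or33.
pose ok y := spanned W [:: y] a.
have next y : ok y -> exists yp : A * int * A,
    [/\ ok yp.1.1, 1 < `|yp.1.2|, W yp.2 & y = yp.1.1 *~ yp.1.2 + yp.2].
  move=> oky; case: (oky) => n; rewrite lincomb1; set k := n 0%N => Wk.
  have yindep j : W (y *~ j) -> j = 0.
    move=> /(subgroupMz k gW); rewrite -mulrzA => Wyj.
    have /indep : W (a *~ j).
      rewrite -[a](subrK (y *~ k)) mulrzDl -mulrzA mulrC.
      by apply: subgroupD => //; apply: subgroupMz.
    by [].
  have k0 : k != 0.
    by apply/eqP => k0; apply: nWa; rewrite k0 mulr0z subr0 in Wk.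
  have /existsNP[m /existsNP[d /existsNP[x]]] : ~ pure_indep W [:: y].
    move=> iy; apply: nex; exists y; split=> //; exists k => //.
    exists (fun=> 1); rewrite lincomb1 mulr1z -opprB.
    exact: subgroupN.
  rewrite lincomb1; set j := m 0%N => /not_implyP[Wx ndj].
  have {}ndj : ~~ (d %| j)%Z.
    by apply/negP => dj; apply: ndj => -[].
  have d0 : d != 0.
    apply/eqP => d0; move: ndj Wx; rewrite d0 mulr0z sub0r dvd0z => j0 Wj.
    by move/eqP: j0; apply; apply: yindep; rewrite -[_ *~ _]opprK; apply: subgroupN.
  have g0 : gcdz d j != 0 by rewrite gcdz_eq0 negb_and d0.
  have [/dvdzP[d1 Ed] /dvdzP[j1 Ej]] := (dvdz_gcdl d j, dvdz_gcdr d j).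
  have [u [v uv]] := Bezoutz d j; set g := gcdz d j in g0 Ed Ej uv.
  have {}uv : u * d1 + v * j1 = 1.
    by apply: (mulIf g0); rewrite mul1r mulrDl -!mulrA -Ed -Ej.
  (* Purity of [W] allows division by the gcd [g]; the Bezout combination [y'] of [y] and [x] then
     satisfies [y = y' *~ d1 + w]. The factor [d1] is not a unit because [d] does not divide [j]. *)
  have Wxy : W (x *~ d1 - y *~ j1).
    by apply: (pW _ g) => //; rewrite mulrzBl -!mulrzA -Ed -Ej.
  pose y' := y *~ u + x *~ v; pose w := - ((x *~ d1 - y *~ j1) *~ v).
  have Ww : W w by apply: subgroupN => //; apply: subgroupMz.
  have Ey : y = y' *~ d1 + w.
    rewrite /w /y' mulrzBl mulrzDl opprB -!mulrzA [v * d1]mulrC addrACA.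
    by rewrite subrr addr0 -mulrzDr [j1 * v]mulrC uv mulr1z.
  exists (y', d1, w); split=> //=.
    exists (fun=> d1 * k); rewrite lincomb1.
    have -> : a - y' *~ (d1 * k) = (a - y *~ k) + w *~ k.
      by rewrite [in RHS]Ey [in RHS]mulrzDl [in RHS]opprD addrA subrK mulrzA.
    by apply: subgroupD => //; apply: subgroupMz.
  have d10 : d1 != 0 by apply: contraNneq d0 => d10; rewrite Ed d10 mul0r.
  have : `|d1| <> 1.
    move=> d11; case/negP: ndj; rewrite Ed -[j]mul1r Ej mul1r.
    by rewrite dvdz_mul // /dvdz; have -> : `|d1|%N = 1%N by lia.
  by lia.
have [a0 ok0] : exists a0 : {y | ok y}, sval a0 = a.
  have oka : ok a by exists (fun=> 1); rewrite lincomb1 mulr1z subrr; case: gW.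
  by exists (exist _ a oka).
have /choice[f fP] : forall y : {y | ok y}, exists yp : {y | ok y} * (int * A),
    [/\ 1 < `|yp.2.1|, W yp.2.2 & sval y = sval yp.1 *~ yp.2.1 + yp.2.2].
  case=> y oky; have [[[y' p] w] [/= ok' p1 Ww E]] := next y oky.
  by exists (exist _ y' ok', (p, w)).
pose Z i := iter i (fun y => (f y).1) a0.
exists (fun i => (f (Z i)).2.1), (fun i => (f (Z i)).2.2), (fun i => sval (Z i)).
by split=> // i; case: (fP (Z i)).
Qed.

(** Induction on [l] by [pure_step]. The clause on [hull] confines [u] to the pure closure of [z]
    and [l] over [G], so that a dependence involving [u] can later be traced back to the given
    generators. *)
Lemma pure_indep_or_runaway G z l : subgroup G -> pure G -> pure_indep G z ->
  exists u, [/\ pure_indep G (z ++ u),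
    {in u, forall x, hull (spanned G (z ++ l)) x} &
    {in l, forall x, spanned G (z ++ u) x} \/
    exists a p w Y, a \in l /\ runaway (spanned G (z ++ u)) a p w Y].
Proof.
move=> gG pG; elim: l z => [|a l IHl] z iz.
  by exists [::]; rewrite cats0; split=> //; left.
have gz e := subgroup_spanned e gG.
have [za|[a' [ia' aa' ha']]|[p [w [Y rY]]]] := pure_step a (gz z) (pure_spanned gG pG iz).
- have [u [iu hu ul]] := IHl z iz; exists u; split=> //.
    move=> x /hu; apply: hullS; apply: spanned_min => // [y Gy|y].
      exact: sub_spanned.
    rewrite mem_cat => /orP[yz|yl]; apply: mem_spanned => //.
      by rewrite mem_cat yz.
    by rewrite mem_cat inE yl !orbT.
  case: ul => [ul|[b [p [w [Y [bl rY]]]]]]; [left|right].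
    move=> x; rewrite inE => /orP[/eqP ->|/ul//].
    by rewrite spanned_cat //; apply: sub_spanned.
  by exists b, p, w, Y; rewrite inE bl orbT.
- have iza : pure_indep G (z ++ [:: a']) by apply: pure_indep_cat.
  have [u [iu hu ul]] := IHl _ iza; exists (a' :: u); rewrite -cat_rcons -cats1.
  have ha'' : hull (spanned G (z ++ a :: l)) a'.
    rewrite -cat1s catA spanned_cat // [spanned G (z ++ _)]spanned_cat //.
    by move: ha'; apply: hullS; apply: sub_spanned.
  split=> //.
    move=> x; rewrite inE => /orP[/eqP -> //|/hu].
    apply: hull_min; last exact: pure_hull.
    apply: spanned_min; [exact/subgroup_hull| |].
      by move=> y Gy; apply/sub_hull/sub_spanned.
    move=> y; rewrite mem_cat cats1 mem_rcons inE -orbA => /or3P[/eqP -> //|yz|yl].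
      by apply/sub_hull/mem_spanned; rewrite // mem_cat yz.
    by apply/sub_hull/mem_spanned; rewrite // mem_cat inE yl !orbT.
  case: ul => [ul|[b [p [w [Y [bl rY]]]]]]; [left|right].
    move=> x; rewrite inE => /orP[/eqP ->|/ul//].
    by rewrite spanned_cat //; apply: sub_spanned; rewrite spanned_cat.
  by exists b, p, w, Y; rewrite inE bl orbT.
- exists [::]; rewrite cats0; split=> //; right.
  by exists a, p, w, Y; rewrite mem_head.
Qed.

End LinearCombinations.

(** * Runaway chains *)

Lemma uncountable_cantor : ~ countable [set: nat -> bool].
Proof.
move=> /card_le_setTP[f injf].
have [_ nf] := (iffLR (card_lt_continuumP _)) card_lt_continuum_nat.
apply: (nf (fun X => f (fun n => `[< X n >]))) => X Y /injf E.
apply/funext => n; move: (congr1 (@^~ n) E) => /= En.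
by apply/propext; split=> /asboolP; rewrite (En, esym En) => /asboolP.
Qed.

Lemma first_difference (T : eqType) (c c' : nat -> T) :
  c <> c' -> exists n, (forall i, (i < n)%N -> c i = c' i) /\ c n != c' n.
Proof.
move=> cc'; have ex : exists n, c n != c' n.
  apply: contrapT => /forallNP nex; apply: cc'; apply/funext => n.
  by apply/eqP/negPn/negP/nex.
case: (ex_minnP ex) => n ncn nmin; exists n; split=> // i ltin.
by apply/eqP/negPn/negP => /nmin; rewrite leqNgt ltin.
Qed.

(* The value in [Q/Z] prescribed at the [i]-th term of a runaway chain: the
   relation between consecutive terms leaves the digit [c i] free. *)
Fixpoint coded_value (p : nat -> int) (c : nat -> bool) (i : nat) : rat :=
  if i is j.+1 then (coded_value p c j + (c j)%:R) / (p j)%:~R else 0.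

Lemma eq_coded_value p p' c c' n :
  (forall i, (i < n)%N -> p i = p' i) -> (forall i, (i < n)%N -> c i = c' i) ->
  coded_value p c n = coded_value p' c' n.
Proof.
elim: n => //= n IHn pp' cc'; rewrite pp' // cc' // IHn // => i ltin.
  by apply: pp'; apply: ltnW.
by apply: cc'; apply: ltnW.
Qed.

Section Runaway.
Variable A : zmodType.

(** The relation between [Y i] and [Y i.+1] is respected modulo Z: [w i] has value 0, and the digit
    [c i] is an integer, hence absorbed by the indeterminacy of [gam]. No [Y i] has a nonzero
    multiple in the domain of [gam], so nothing else constrains the values. *)
Lemma runaway_graph (gam : set (A * rat)) W a p w Y c :
  subgroup gam -> (forall q, gam (0, q) <-> q \is a Num.int) ->
  (forall x, W x -> gam (x, 0)) -> runaway W a p w Y ->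
  (forall k q, gam (a *~ k, q) -> k = 0) ->
  exists gam', [/\ subgroup gam', gam `<=` gam',
    forall q, gam' (0, q) -> q \is a Num.int &
    forall i, gam' (Y i, coded_value p c i)].
Proof.
move=> gg z0 gW [Y0 _ Ww p1 Yrec] indep; set h := coded_value p c.
have p0 i : (p i)%:~R != 0 :> rat by rewrite intr_eq0; have := p1 i; lia.
have hrec i : h i = h i.+1 *~ p i - (c i)%:R by rewrite /h /= -mulrzr divfK // addrK.
have indepY i k q : gam (Y i *~ k, q) -> k = 0.
  elim: i k q => [|i IHi] k q; first by rewrite Y0; apply: indep.
  move=> gk; apply: (IHi _ (q *~ p i)); rewrite Yrec mulrzDl.
  have g1 := subgroupMz (p i) gg gk; have g2 := subgroupMz k gg (gW _ (Ww i)).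
  rewrite !pair_mulrz mul0rz in g1 g2.
  have : gam (Y i.+1 *~ k *~ p i + w i *~ k, q *~ p i + 0) := subgroupD gg g1 g2.
  by rewrite addr0 -!mulrzA mulrC.
pose gam' := [set v : A * rat | exists i k x q,
  gam (x, q) /\ v = (x + Y i *~ k, q + h i *~ k)].
have raise i k x q d : gam (x, q) -> exists k' x' q', gam (x', q') /\
    (x + Y i *~ k, q + h i *~ k) = (x' + Y (d + i)%N *~ k', q' + h (d + i)%N *~ k').
  elim: d => [|d IHd] gx; first by exists k, x, q.
  have [k' [x' [q' [gx' ->]]]] := IHd gx; rewrite addSn; set j := (d + i)%N.
  have gck : gam (0, - (c j)%:R *~ k').
    by apply/z0; rewrite rpredMz ?rpredN ?rpred_nat.
  exists (p j * k'), (x' + w j *~ k'), (q' - (c j)%:R *~ k'); split.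
    have g2 := subgroupMz k' gg (gW _ (Ww j)); rewrite pair_mulrz mul0rz in g2.
    have : gam (x' + w j *~ k' + 0, q' + 0 + - (c j)%:R *~ k').
      exact: (subgroupD gg (subgroupD gg gx' g2) gck).
    by rewrite !addr0 mulNrz.
  rewrite Yrec hrec mulrzBl mulrzDl -!mulrzA; congr (_, _).
    by rewrite -addrA [w j *~ k' + _]addrC.
  by rewrite -addrA [- _ + _]addrC.
exists gam'; split.
- split; first by exists 0%N, 0, 0, 0; rewrite !mulr0z !addr0; split=> //; case: gg.
  move=> _ _ [i [k [x [q [gx ->]]]]] [j [l [y [r [gy ->]]]]].
  have [k1 [x1 [q1 [gx1 ->]]]] := raise i k x q j gx.
  have [l1 [y1 [r1 [gy1 ->]]]] := raise j l y r i gy.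
  exists (j + i)%N, (k1 - l1), (x1 - y1), (q1 - r1); split.
    exact: (gg.2 _ _ gx1 gy1).
  rewrite [(i + j)%N]addnC !mulrzBr [LHS]surjective_pairing !raddfB /=.
  by rewrite !opprD ![_ + _ *~ _ + _]addrACA.
- move=> [x q] gx; exists 0%N, 0, x, q; by rewrite !mulr0z !addr0.
- move=> q [i [k [x [r [gx [/esym/eqP]]]]]]; rewrite addr_eq0 => /eqP Ex ->.
  have k0 : k = 0.
    apply: (indepY i k (- r)); have : gam (- x, - r) := subgroupN gg gx.
    by rewrite Ex opprK.
  by rewrite Ex k0 !mulr0z oppr0 in gx *; rewrite addr0; apply/z0.
- move=> i; exists i, 1, 0, 0; rewrite !mulr1z !add0r; split=> //.
  by case: gg.
Qed.

(** Division in Q is unique, so the values at [Y n.+1] are computed from those at [a] and at [w i]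
    with [i <= n], and agree. The two coded values at [n.+1] would then differ by an integer, yet
    they differ by plus or minus [1 / p n], where [p n] is not a unit. *)
Lemma runaway_clash (f f' : {additive A -> rat}) W W' a a' p p' w w' Y Y' c c' n :
  runaway W a p w Y -> runaway W' a' p' w' Y' ->
  f a = f' a' -> (forall i, (i <= n)%N -> p i = p' i) ->
  (forall i, (i <= n)%N -> f (w i) = f' (w' i)) ->
  (forall i, (i < n)%N -> c i = c' i) -> c n != c' n ->
  f (Y n.+1) - coded_value p c n.+1 \is a Num.int ->
  f' (Y' n.+1) - coded_value p' c' n.+1 \is a Num.int -> False.
Proof.
move=> [Y0 _ _ p1 Yrec] [Y0' _ _ _ Yrec'] faa pp' ww' cc' ncn.
have fY i : (i <= n.+1)%N -> f (Y i) = f' (Y' i).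
  elim: i => [|i IHi] lti; first by rewrite Y0 Y0'.
  have := IHi (ltnW lti); rewrite Yrec Yrec' !raddfD !raddfMz /= ww' // => /addIr.
  rewrite -pp' // => /eqP; rewrite -subr_eq0 -mulrzBl mulrz_eq0 subr_eq0.
  by case/orP => [|/eqP //]; have := p1 i; lia.
move=> ih ih'; have := rpredB ih' ih; rewrite fY // opprB addrC addrA subrK /=.
rewrite -pp' // (eq_coded_value (p' := p) (c' := c)); last 2 first.
- by move=> i ltin; rewrite -pp' // ltnW.
- by move=> i ltin; rewrite -cc'.
rewrite -mulrBl opprD addrACA subrr add0r.
have p0 : (p n)%:~R != 0 :> rat by rewrite intr_eq0; have := p1 n; lia.
case/intrP => m /(congr1 (fun x => x * (p n)%:~R)); rewrite divfK //.
have -> : (c n)%:R - (c' n)%:R = (((c n)%:Z - (c' n)%:Z) %:~R) :> rat.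
  by rewrite rmorphB.
rewrite -rmorphM => /intr_inj E; have := p1 n; have := congr1 absz E.
rewrite abszM.
by case: (c n) (c' n) ncn {E} => -[] //= _; case: m => [[|m]|m] /=; nia.
Qed.

Lemma pure0_no_runaway (z : seq A) a p w Y :
  lifting A -> ~ runaway (int_span z) a p w Y.
Proof.
move=> LA rY; have [Y0 indep Ww p1 Yrec] := rY.
pose gam0 := [set x : A * rat | int_span z x.1 /\ x.2 \is a Num.int].
have gg0 : subgroup gam0.
  split=> [|x y [x1 x2] [y1 y2]]; first by split; [case: (subgroup_int_span z)|rewrite rpred0].
  by split; [apply: (subgroup_int_span z).2|rewrite rpredB].
have /choice[f fP] : forall c, exists f : {additive A -> rat},
    (forall x, int_span z x -> f x \is a Num.int) /\
    forall i, f (Y i) - coded_value p c i \is a Num.int.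
  move=> c; have [|||gam [gg sub zg gY]] := runaway_graph c gg0 _ _ rY.
  - by move=> q; split=> [[]//|iq]; split=> //; case: (subgroup_int_span z).
  - by move=> x zx; split; rewrite ?rpred0.
  - by move=> k q [/indep].
  have [f fP] := lifting_graph LA gg zg; exists f; split=> [x zx|i]; last exact/fP/gY.
  by rewrite -[f x]subr0; apply/fP/sub; split; rewrite ?rpred0.
(* Pigeonhole: the values on [z] and at [a] range over a countable type, and those on [z] determine
   the values at all [w i]. *)
have [[fz fa] ncn] := uncountable_fiber_countType
  (fun c => (map (f c) z, f c a)) uncountable_cantor.
have [c [c' [/= [_ [fz1 fa1]] [_ [fz2 fa2]] /first_difference[n [ltn cn]]]]] :=
  uncountable_pair ncn.
have fe x : int_span z x -> f c x = f c' x.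
  move=> /int_spanP[m ->]; rewrite !raddf_lincomb; apply: eq_bigr => i _.
  by move: (congr1 (nth 0 ^~ i) (etrans fz1 (esym fz2))); rewrite !(nth_map 0) // => ->.
apply: (@runaway_clash (f c) (f c') _ _ _ _ _ _ _ _ _ _ _ _ _ rY rY _ _ _ ltn cn) => //.
- exact: (etrans fa1 (esym fa2)).
- by move=> i _; apply: fe.
- by case: (fP c).
- by case: (fP c').
Qed.

End Runaway.

(** * Slaloms *)

Section Slalom.
Variables (A : eqType) (b : A -> nat -> nat) (f : nat -> nat).

Let code (x : A) (i : nat) : seq nat := mkseq (b x) (f i).

(** Localization forcing: a finite slalom together with finitely many promised elements. Bounding
    their number by the length leaves room for all their codes at the next stage. *)
Definition slalom_ok (p : seq (seq (seq nat)) * seq A) : Prop :=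
  (size p.2 <= size p.1)%N /\ forall i, (size (nth [::] p.1 i) <= i)%N.

Definition slalom_cond := {p | slalom_ok p}.
Implicit Types p q r : slalom_cond.

Definition slalom_le p q : Prop :=
  [/\ exists T, (sval q).1 = (sval p).1 ++ T, {subset (sval p).2 <= (sval q).2} &
      {in (sval p).2, forall x i, (size (sval p).1 <= i < size (sval q).1)%N ->
        code x i \in nth [::] (sval q).1 i}].

Lemma slalom_le_refl p : slalom_le p p.
Proof.
split=> //; first by exists [::]; rewrite cats0.
by move=> x _ i; case: ltnP => // h; rewrite leqNgt h.
Qed.

Lemma slalom_le_trans p q r : slalom_le p q -> slalom_le q r -> slalom_le p r.
Proof.
move=> [[T ET] sF cF] [[T' ET'] sF' cF']; split.
- by exists (T ++ T'); rewrite catA -ET.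
- by move=> x /sF/sF'.
- move=> x xp i /andP[lei lti]; have [ltiq|leqi] := ltnP i (size (sval q).1).
    by rewrite ET' nth_cat ltiq; apply: cF; rewrite // lei.
  by apply: cF'; rewrite ?leqi //; apply: sF.
Qed.

Lemma slalom_lengthen p k : exists q, [/\ slalom_le p q,
  size (sval q).1 = (size (sval p).1 + k)%N & (sval q).2 = (sval p).2].
Proof.
elim: k => [|k [q [pq sq Fq]]].
  by exists p; rewrite addn0; split=> //; apply: slalom_le_refl.
pose T := [seq code x (size (sval q).1) | x <- (sval q).2].
have [qF qS] := svalP q.
have ok : slalom_ok (rcons (sval q).1 T, (sval q).2).
  split=> /=; first by rewrite size_rcons leqW.
  move=> i; rewrite nth_rcons; case: ltnP => // lei; case: eqP => // ->.
  by rewrite size_map.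
exists (exist _ _ ok); split=> //=; last by rewrite size_rcons sq addnS.
apply: slalom_le_trans pq _; split=> //=; first by exists [:: T]; rewrite cats1.
move=> x xq i; rewrite size_rcons ltnS -eqn_leq nth_rcons => /eqP <-.
by rewrite ltnn eqxx; apply: map_f.
Qed.

Lemma slalom : martin_axiom -> card_lt [set: A] continuum ->
  exists T : nat -> seq (seq nat), (forall i, size (T i) <= i)%N /\
    forall x, exists n, forall i, (n <= i)%N -> code x i \in T i.
Proof.
move=> MA ltA.
pose D (j : A + nat) : set slalom_cond := match j with
  | inl x => [set p | x \in (sval p).2]
  | inr i => [set p | (i < size (sval p).1)%N] end.
have ok0 : slalom_ok ([::], [::]) by split=> // i; rewrite nth_nil.
have [||||||G [dirG meetG]] := martin_axiom_preorder (D := D) (le := slalom_le) MA.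
- by exists (exist _ _ ok0).
- exact: slalom_le_refl.
- exact: slalom_le_trans.
(* Adding as many stages as there are promises makes room for twice as many. Two conditions with the
   same lengthened slalom and equally many promises can therefore pool their promises. *)
- move=> S ncS; have /choice[lg lgP] p := slalom_lengthen p (size (sval p).2).
  have [[T k] ncT] := uncountable_fiber_countType
    (fun p => ((sval (lg p)).1, size (sval p).2)) ncS.
  have [p [q [[Sp [Tp kp]] [Sq [Tq kq]] pq]]] := uncountable_pair ncT.
  have [pl szp Fp] := lgP p; have [ql szq Fq] := lgP q.
  have ok : slalom_ok (T, (sval p).2 ++ (sval q).2).
    split=> /=; last by rewrite -Tp; case: (svalP (lg p)).
    have [] := svalP p; rewrite -Tp size_cat szp kp kq; lia.
  exists p, q, (exist _ _ ok); split=> //.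
    apply: slalom_le_trans pl _; split=> /=; first by exists [::]; rewrite cats0 Tp.
      by move=> x; rewrite Fp mem_cat => ->.
    by move=> x _ i; rewrite Tp; case: ltnP => // h; rewrite leqNgt h.
  apply: slalom_le_trans ql _; split=> /=; first by exists [::]; rewrite cats0 Tq.
    by move=> x; rewrite Fq mem_cat orbC => ->.
  by move=> x _ i; rewrite Tq; case: ltnP => // h; rewrite leqNgt h.
- exact/card_lt_continuum_sum/card_lt_continuum_nat.
- case=> [x|i] p; last first.
    have [q [pq sq _]] := slalom_lengthen p i.+1.
    by exists q => //=; rewrite sq addnS ltnS leq_addl.
  (* One more stage pays for one more promise. *)
  have [q [pq sq Fq]] := slalom_lengthen p 1; have [_ qS] := svalP q.
  have ok : slalom_ok ((sval q).1, x :: (sval q).2).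
    by split=> //=; rewrite Fq sq addn1 ltnS; case: (svalP p).
  exists (exist _ _ ok); rewrite /= ?mem_head //; apply: slalom_le_trans pq _.
  split=> /=; first by exists [::]; rewrite cats0.
    by move=> y yq; rewrite inE yq orbT.
  by move=> y _ i; case: ltnP => // h; rewrite leqNgt h.
have nthG p q i : G p -> G q -> (i < size (sval p).1)%N -> (i < size (sval q).1)%N ->
    nth [::] (sval p).1 i = nth [::] (sval q).1 i.
  move=> Gp Gq ip iq; have [r [_ [[T ET] _ _] [[T' ET'] _ _]]] := dirG _ _ Gp Gq.
  by move: (congr1 (nth [::] ^~ i) (etrans (esym ET) ET')); rewrite !nth_cat ip iq.
have /choice[g gP] i : exists p, G p /\ (i < size (sval p).1)%N.
  by have [p Gp ip] := meetG (inr i); exists p.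
exists (fun i => nth [::] (sval (g i)).1 i); split=> [i|x].
  by case: (svalP (g i)).
have [p Gp px] := meetG (inl x); exists (size (sval p).1) => i lei.
have [Gg ig] := gP i; have [r [Gr [_ sF cF] [[T ET] _ _]]] := dirG _ _ Gp Gg.
have ir : (i < size (sval r).1)%N by rewrite ET size_cat ltn_addr.
by rewrite (nthG _ _ _ Gg Gr ig ir); apply: cF; rewrite // lei.
Qed.

End Slalom.

(* The slalom has at most [i] nodes of length [f i] at stage [i]. Which of them
   is an initial segment of [b x] is recorded by [c x] at places below
   [f i.-1], so [c x] and [c y] branch before [b x] and [b y] do. *)
Lemma early_branching (A : eqType) (X : set A) (b : A -> nat -> nat) :
  martin_axiom -> card_lt [set: A] continuum -> ~ countable X ->
  exists X' (c : A -> nat -> bool), [/\ X' `<=` X, ~ countable X' &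
    forall x y, X' x -> X' y -> x <> y -> exists n,
      [/\ forall i, (i < n)%N -> c x i = c y i, c x n != c y n &
          forall i, (i <= n)%N -> b x i = b y i]].
Proof.
move=> MA ltA ncX; have [[e inje] _] := (iffLR (card_lt_continuumP A)) ltA.
pose pk (i j : nat) : nat := choice.pickle (i, j).
have pk_inj i j i' j' : pk i j = pk i' j' -> i = i' /\ j = j'.
  by move=> /(pcan_inj (@choice.pickleK _)) [].
(* Mixing in the injection [e] makes [b'] injective, so that distinct elements do branch. *)
pose b' x i := pk (b x i) `[< e x i >].
(* Large enough to exceed [i] and the place [pk i.+1 j] of every node of stage [i.+1], since that
   stage has at most [i.+1] nodes. *)
pose f i := (i + \sum_(j < i.+1) pk i.+1 j).+1.
have f_ge i : (i < f i)%N by rewrite ltnS leq_addr.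
have f_pk i j : (j < i.+1)%N -> (pk i.+1 j < f i)%N.
  by move=> ltj; rewrite ltnS (bigD1 (Ordinal ltj)) //= addnCA leq_addr.
have b'_inj x y : b' x = b' y -> x = y.
  move=> E; apply: inje; apply/funext => i; apply/propext.
  have [_ Ei] := pk_inj _ _ _ _ (congr1 (@^~ i) E).
  have {}Ei : `[< e x i >] = `[< e y i >] by move: Ei; do 2 case: asboolP.
  by split=> /asboolP; rewrite (Ei, esym Ei) => /asboolP.
have [T [sT coverT]] := slalom b' f MA ltA.
have [N NP] := choice coverT.
have [[n v] ncv] := uncountable_fiber_countType
  (fun x => (N x, mkseq (b' x) (f (N x)))) ncX.
pose c x m := `[< exists i j, [/\ m = pk i j, (j < size (T i))%N &
  nth [::] (T i) j = mkseq (b' x) (f i)] >].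
exists [set x | X x /\ (N x, mkseq (b' x) (f (N x))) = (n, v)], c; split=> //.
  by move=> x [].
move=> x y [_ [Nx vx]] [_ [Ny vy]] xy; subst n.
have nth_b z i k : (k < f i)%N -> nth 0%N (mkseq (b' z) (f i)) k = b' z k.
  by move=> ltk; rewrite nth_mkseq.
have ex : exists d, mkseq (b' x) (f (N x + d)%N) != mkseq (b' y) (f (N x + d)%N).
  have [k [_ bk]] : exists k, (forall i, (i < k)%N -> b' x i = b' y i) /\ b' x k != b' y k.
    by apply: first_difference => /b'_inj.
  exists k; apply/eqP => /(congr1 (nth 0%N ^~ k)).
  have ltk : (k < f (N x + k)%N)%N by apply: leq_trans (f_ge _); rewrite ltnS leq_addl.
  by rewrite !nth_b //; apply/eqP.
(* The first stage at which the prefixes differ comes after [N x], because at [N x] both equal [v].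
   Hence the prefix of [x] at stage [i.+1] is a node of the slalom, while at stage [i] the prefixes
   still agree. *)
case: (ex_minnP ex) => -[|d] bd dmin.
  by move: bd; rewrite addn0 vx -Ny vy eqxx.
rewrite addnS in bd; set i := (N x + d)%N in bd.
have bi : mkseq (b' x) (f i) = mkseq (b' y) (f i).
  by apply/eqP/negPn/negP => /dmin; rewrite ltnn.
have eq_b k : (k < f i)%N -> b x k = b y k.
  by move=> ltk; move: (congr1 (nth 0%N ^~ k) bi); rewrite !nth_b // => /pk_inj[].
have xT : mkseq (b' x) (f i.+1) \in T i.+1 by apply: NP; rewrite leqW // leq_addr.
(* The digit at [pk i.+1 j] is true for [x] and false for [y]; the first difference of the digits is
   no later, hence below [f i], where [b x] and [b y] coincide. *)
set j := index (mkseq (b' x) (f i.+1)) (T i.+1).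
have ltj : (j < size (T i.+1))%N by rewrite index_mem.
have cx : c x (pk i.+1 j) by apply/asboolP; exists i.+1, j; rewrite nth_index.
have cy : ~~ c y (pk i.+1 j).
  apply/negP => /asboolP[i' [j' [/pk_inj[<- <-] _]]].
  by rewrite nth_index // => E; rewrite E eqxx in bd.
have [|m [cm ncm]] := @first_difference _ (c x) (c y).
  by move=> E; rewrite E (negPf cy) in cx.
exists m; split=> // k lek; apply: eq_b.
have lem : (m <= pk i.+1 j)%N.
  by rewrite leqNgt; apply/negP => /cm E; rewrite E (negPf cy) in cx.
apply: leq_ltn_trans lek (leq_ltn_trans lem _); apply: f_pk.
exact: leq_trans ltj (sT _).
Qed.

(** * Uncountable families of runaway chains *)

Section Generated.
Variable M : zmodType.
Implicit Types (S : set M) (e : seq M).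

Definition generated S : set M :=
  [set x | exists2 s : seq M, {in s, forall y, S y} & int_span s x].

Lemma sub_generated S : S `<=` generated S.
Proof.
move=> x Sx; exists [:: x]; first by move=> y; rewrite inE => /eqP ->.
by apply: mem_int_span; rewrite mem_head.
Qed.

Lemma subgroup_generated S : subgroup (generated S).
Proof.
split; first by exists [::] => //; case: (subgroup_int_span ([::] : seq M)).
move=> x y [s sS sx] [t tS ty]; exists (s ++ t).
  by move=> z; rewrite mem_cat => /orP[/sS|/tS].
apply: (subgroup_int_span _).2; first exact: int_span_cat sx.
apply: int_span_min ty; first exact: subgroup_int_span.
by move=> z zt; apply: mem_int_span; rewrite mem_cat zt orbT.
Qed.

Lemma generated_min S H : subgroup H -> S `<=` H -> generated S `<=` H.
Proof. by move=> gH SH x [s sS]; apply: int_span_min => // y /sS/SH. Qed.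

Lemma countable_int_span e : countable (int_span e).
Proof.
apply: countable_sub (countable_image (fun s => lincomb e (nth 0 s)) (countableP [set: seq int])).
move=> x /int_spanP[n ->]; exists (mkseq n (size e)) => //.
by apply: eq_lincomb => i lti; rewrite nth_mkseq.
Qed.

Lemma countable_generated S : countable S -> countable (generated S).
Proof.
move=> /countable_seqs cS; have -> : generated S =
  \bigcup_(s in [set s : seq M | {in s, forall y, S y}]) int_span s.
  by apply/seteqP; split=> x [s sS sx]; exists s.
by apply: bigcup_countable => // s _; apply: countable_int_span.
Qed.

Lemma countable_spanned G e : subgroup G -> countable G -> countable (spanned G e).
Proof.
move=> gG cG; have /countable_generated : countable (G `|` [set` e]).
  by apply: countableU => //; apply/finite_set_countable/finite_seq.
apply: countable_sub; apply: spanned_min (subgroup_generated _) _ _ => [x Gx|x xe].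
  by apply: sub_generated; left.
by apply: sub_generated; right.
Qed.

End Generated.

Section RunawayFamily.
Variable A : zmodType.
Implicit Types (G H W : set A) (u : seq A) (a x : A).

Definition indep_mod H u a : Prop := forall n m, H (lincomb u n + a *~ m) ->
  m = 0 /\ forall i, (i < size u)%N -> n i = 0.

(** The value 0 is first prescribed on [u], which is consistent by independence over the domain of
    [gam]; [runaway_graph] then applies with [spanned G u] as base. *)
Lemma runaway_graph_spanned (gam : set (A * rat)) G u a p w Y c :
  subgroup gam -> (forall q, gam (0, q) <-> q \is a Num.int) ->
  (forall x, G x -> gam (x, 0)) -> runaway (spanned G u) a p w Y ->
  indep_mod (fst @` gam) u a ->
  exists gam', [/\ subgroup gam', gam `<=` gam',
    forall q, gam' (0, q) -> q \is a Num.int, {in u, forall x, gam' (x, 0)} &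
    forall i, gam' (Y i, coded_value p c i)].
Proof.
move=> gg z0 Gg rY ind.
pose gam1 := [set v : A * rat | exists n, gam (v.1 - lincomb u n, v.2)].
have sub1 : gam `<=` gam1 by move=> [x q] gx; exists (fun=> 0); rewrite lincomb0 subr0.
have gg1 : subgroup gam1.
  split; first by apply: sub1; case: gg.
  move=> [x q] [y r] [n gx] [m gy]; exists (fun i => n i - m i).
  have : gam (x - lincomb u n - (y - lincomb u m), q - r) := gg.2 _ _ gx gy.
  congr (gam (_, _)); rewrite lincombB /= !opprB.
  by rewrite addrACA [in RHS]addrACA [- y - _]addrC.
have gu : {in u, forall x, gam1 (x, 0)}.
  move=> x /(nthP 0)[i lti <-]; exists (fun j => (i == j)%:Z).
  by rewrite lincomb_delta //= subrr; case: gg.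
have gam1E n m x q : gam (x - lincomb u n, q) -> x = a *~ m ->
    m = 0 /\ gam (x, q).
  move=> gx xE; have [|m0 n0] := ind (fun i => - n i) m.
    exists (x - lincomb u n, q) => //=; rewrite xE addrC; congr (_ + _).
    by rewrite -[LHS]mulrN1z -lincombM; apply: eq_lincomb => i _; rewrite mulrN1.
  split=> //; suff : lincomb u n = 0 by move=> n0'; rewrite n0' subr0 in gx.
  rewrite -(lincomb0 u); apply: eq_lincomb => i lti.
  by rewrite -[n i]opprK n0 // oppr0.
have z1 q : gam1 (0, q) <-> q \is a Num.int.
  split; last by move=> /z0/sub1.
  by case=> n gn; apply/z0; have [] := gam1E n 0 0 q gn; rewrite ?mulr0z.
have [||gam' [gg' sub' z' gY']] := runaway_graph c gg1 z1 _ rY.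
- move=> x [n Gx]; exists n; exact: Gg.
- by move=> k q [n gn]; have [] := gam1E n k _ q gn.
by exists gam'; split=> // [v /sub1/sub'//|x /gu/sub'].
Qed.

End RunawayFamily.

(** Zorn's lemma gives a maximal [V] on which the prescriptions are consistent. A countable [V] has
    a countable domain of prescriptions, over which some further chain is independent and could be
    added. So [V] is uncountable, and one lift for all of [V] meets [runaway_clash]. *)
Lemma no_runaway_family (A : zmodType) (G X : set A) (u : A -> seq A)
    (p : A -> nat -> int) (w Y : A -> nat -> A) :
  martin_axiom -> card_lt [set: A] continuum -> lifting A ->
  subgroup G -> countable G -> ~ countable X ->
  (forall a, X a -> runaway (spanned G (u a)) a (p a) (w a) (Y a)) ->
  (forall H, subgroup H -> countable H -> G `<=` H ->
    countable [set a | X a /\ ~ indep_mod H (u a) a]) ->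
  False.
Proof.
move=> MA ltA LA gG cG ncX rX indX.
have /choice[k kP] (ai : A * nat) : exists n : nat -> int, X ai.1 ->
    G (w ai.1 ai.2 - lincomb (u ai.1) n).
  have [Xa|nXa] := pselect (X ai.1); last by exists (fun=> 0).
  by have [_ _ /(_ ai.2)[n Gn] _ _] := rX _ Xa; exists n.
pose g a i := w a i - lincomb (u a) (k (a, i)).
have /pcard_injP[code code_inj] := cG.
(* All that determines the value of a lift at [w a i] once its values on [u a] and on [G] are known:
   coefficients over [u a] and the remainder in [G], together with the divisor [p a i]. *)
pose b a i : nat :=
  choice.pickle (p a i, mkseq (k (a, i)) (size (u a)), code (g a i)).
have [X' [c [sX' ncX' branch]]] := early_branching b MA ltA ncX.
pose h a := coded_value (p a) (c a).
pose gens (V : set A) : set (A * rat) := [set v | (G v.1 /\ v.2 \is a Num.int) \/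
  exists2 a, V a & (v.1 \in u a /\ v.2 = 0) \/ exists i, v = (Y a i, h a i)].
have gensS V V' : V `<=` V' -> gens V `<=` gens V'.
  by move=> sV v [Gv|[a /sV Va av]]; [left|right; exists a].
pose Q V := V `<=` X' /\ forall q, generated (gens V) (0, q) -> q \is a Num.int.
have Q0 : Q set0.
  split=> // q; pose K := [set v : A * rat | G v.1 /\ v.2 \is a Num.int].
  suff : generated (gens set0) `<=` K by move=> /[apply] -[].
  apply: generated_min => [|v [//|[]//]].
  split=> [|x y [x1 x2] [y1 y2]]; first by split; [case: gG|rewrite rpred0].
  by split; [apply: gG.2|rewrite rpredB].
have [|V [[sV QV] maxV]] := @Zorn_bigcup _ Q.
  move=> F FQ totF; split; first by move=> x [V /FQ[sV _] /sV].
  move=> q [s sS s0q].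
  suff [V [FV sgV]] : exists V, (F V \/ V = set0) /\ {in s, forall v, gens V v}.
    have [_] : Q V by case: FV => [/FQ|->].
    by apply; exists s.
  elim: s sS {s0q} => [|v s IHs] sS; first by exists set0; split=> //; right.
  have [|V [FV sgV]] := IHs; first by move=> x xs; apply: sS; rewrite inE xs orbT.
  have [V' [FV' gv]] : exists V, (F V \/ V = set0) /\ gens V v.
    have [Gv|[a [V' FV' V'a] av]] := sS v (mem_head _ _).
      by exists V; split=> //; left.
    by exists V'; split; [left|right; exists a].
  have [VV'|V'V] : V `<=` V' \/ V' `<=` V.
    by case: FV FV' => [FV|->] [FV'|->]; [apply: totF|right|left|left].
    exists V'; split=> // x; rewrite inE => /orP[/eqP -> //|/sgV].
    exact: gensS.
  exists V; split=> // x; rewrite inE => /orP[/eqP ->|/sgV//].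
  exact: gensS gv.
set K := generated (gens V) in QV.
have gK : subgroup K by apply: subgroup_generated.
have Kint q : K (0, q) <-> q \is a Num.int.
  by split=> [/QV //|iq]; apply: sub_generated; left; split=> //; case: gG.
have KG x : G x -> K (x, 0) by move=> Gx; apply: sub_generated; left.
have [cV|ncV] := pselect (countable V).
  have cK : countable K.
    apply: countable_generated.
    apply: (@countable_sub _ _ ((G `*` setT) `|`
      \bigcup_(a in V) ([set` [seq (x, 0) | x <- u a]] `|` range (fun i => (Y a i, h a i))))).
      move=> [x q] [[Gx _]|[a Va axq]]; [left=> //|right; exists a => //].
      case: axq => [[/= xa ->]|[i ->]]; [left|right; by exists i].
      exact: map_f.
    apply: countableU; first by apply: countableX => //; apply: countableP.
    apply: bigcup_countable => // a _; apply: countableU.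
      exact/finite_set_countable/finite_seq.
    exact/countable_image/countableP.
  pose H := fst @` K.
  have gH : subgroup H.
    split; first by exists 0 => //; case: gK.
    by move=> _ _ [x Kx <-] [y Ky <-]; exists (x - y); [apply: gK.2|rewrite raddfB].
  have GH : G `<=` H by move=> x /KG; exists (x, 0).
  have cbad := indX H gH (countable_image _ cK) GH.
  have [a [X'a]] := uncountable_setD ncX' (countableU cV cbad).
  move=> /not_orP[nVa /not_andP[/(_ (sX' _ X'a))//|/contrapT inda]].
  have [gam [gg sub zg gu gY]] :=
    runaway_graph_spanned (c a) gK Kint KG (rX _ (sX' _ X'a)) inda.
  exfalso; apply: (maxV (V `|` [set a])).
    by split=> [x Vx|/(_ a)]; [left|move=> /(_ (or_intror erefl))].
  split; first by move=> x [/sV//|->].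
  move=> q; suff : generated (gens (V `|` [set a])) `<=` gam by move=> /[apply]/zg.
  apply: generated_min gg _ => -[x r] [Gx|[a' [Va'|->] ax]].
  - by apply/sub/sub_generated; left.
  - by apply/sub/sub_generated; right; exists a'.
  - by case: ax => [[/= /gu ? ->]//|[i ->]].
have [f fP] := lifting_graph LA gK QV.
have [[fu fa] ncf] := uncountable_fiber_countType (fun a => (map f (u a), f a)) ncV.
have [a [a' [/= [Va [fu1 fa1]] [Va' [fu2 fa2]] aa']]] := uncountable_pair ncf.
have [n [cn ncn bn]] := branch a a' (sV _ Va) (sV _ Va') aa'.
have Xa := sX' _ (sV _ Va); have Xa' := sX' _ (sV _ Va').
have fuu : map f (u a) = map f (u a') := etrans fu1 (esym fu2).
have suu : size (u a) = size (u a') by move: (congr1 size fuu); rewrite !size_map.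
have bE i : (i <= n)%N -> [/\ p a i = p a' i,
    mkseq (k (a, i)) (size (u a)) = mkseq (k (a', i)) (size (u a')) & g a i = g a' i].
  move=> /bn/(pcan_inj (@choice.pickleK _))[-> -> /code_inj ->] //; rewrite inE.
    exact: (kP (a, i)).
  exact: (kP (a', i)).
apply: (@runaway_clash A f f _ _ a a' _ _ _ _ _ _ (c a) (c a') n (rX _ Xa) (rX _ Xa')) => //.
- exact: (etrans fa1 (esym fa2)).
- by move=> i /bE[].
- move=> i /bE[_ kE gE].
  have wE a0 : w a0 i = g a0 i + lincomb (u a0) (k (a0, i)) by rewrite subrK.
  rewrite !wE gE !raddfD !raddf_lincomb suu; congr (_ + _); apply: eq_bigr => j _.
  have := congr1 (nth 0 ^~ j) kE; rewrite suu !nth_mkseq // => ->.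
  by move: (congr1 (nth 0 ^~ j) fuu); rewrite !(nth_map 0) // ?suu // => ->.
- by apply: fP; apply: sub_generated; right; exists a => //; right; exists n.+1.
- by apply: fP; apply: sub_generated; right; exists a' => //; right; exists n.+1.
Qed.

(* Under Martin's axiom, Whitehead groups satisfy this form of Shelah's criterion. *)
Lemma countable_runaway (A : zmodType) (P : Type) (S : set P) (e : P -> seq A)
    (G : set A) :
  martin_axiom -> card_lt [set: A] continuum -> lifting A ->
  subgroup G -> countable G -> pure G ->
  (forall a, ~ G a -> countable [set y | S y /\ int_span (e y) a]) ->
  countable [set y | S y /\ ~ exists2 z, pure_indep G z &
                              {in e y, forall x, spanned G z x}].
Proof.
move=> MA ltA LA gG cG pG rootS; set bad := (X in countable X).
apply: contrapT => ncbad.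
have /choice[D DP] y : exists d : seq A * A * (nat -> int) * (nat -> A) * (nat -> A),
    let: (u, a, p, w, Y) := d in bad y -> [/\ pure_indep G u,
      {in u, forall x, hull (spanned G (e y)) x}, a \in e y &
      runaway (spanned G u) a p w Y].
  have [[Sy nz]|nb] := pselect (bad y); last first.
    by exists ([::], 0, fun=> 0, fun=> 0, fun=> 0).
  have [u [iu hu [eu|[a [p [w [Y [ae rY]]]]]]]] :=
    pure_indep_or_runaway (e y) gG pG (@pure_indep_nil _ G).
    by case: nz; exists u.
  by exists (u, a, p, w, Y).
pose u y := (D y).1.1.1.1; pose a y := (D y).1.1.1.2; pose p y := (D y).1.1.2.
pose w y := (D y).1.2; pose Y y := (D y).2.
have {}DP y : bad y -> [/\ pure_indep G (u y),
      {in u y, forall x, hull (spanned G (e y)) x}, a y \in e y &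
      runaway (spanned G (u y)) (a y) (p y) (w y) (Y y)].
  by move: (DP y); rewrite /u /a /p /w /Y; case: (D y) => [[[[? ?] ?] ?] ?].
(* A dependence over [H] has a multiple that differs by an element of [G] from some [s] in
   [int_span (e y)]; this [s] lies in [H] but, by purity and independence, not in [G]. There are
   countably many such [s], each met by countably many [y]. *)
have ind H : subgroup H -> countable H -> G `<=` H ->
    countable [set y | bad y /\ ~ indep_mod H (u y) (a y)].
  move=> gH cH GH.
  apply: (@countable_sub _ _ (\bigcup_(s in [set s | H s /\ ~ G s])
    [set y | S y /\ int_span (e y) s])); last first.
    apply: bigcup_countable => [|s [_ /rootS//]].
    by apply: countable_sub cH => s [].
  move=> y [bady]; have [iu hu aey [_ inda _ _ _]] := DP y bady.
  move=> /existsNP[n /existsNP[m /not_implyP[Hv nind]]].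
  set v := lincomb _ _ + _ in Hv.
  have hv : hull (spanned G (e y)) v.
    have gh := subgroup_hull (subgroup_spanned (e y) gG).
    apply: subgroupD => //; first exact: subgroup_lincomb.
    by apply: subgroupMz => //; apply: sub_hull; apply: mem_spanned.
  have [N N0 [l Gl]] := hv.
  exists (lincomb (e y) l); last by split; [case: bady|apply/int_spanP; exists l].
  have El : lincomb (e y) l = v *~ N - (v *~ N - lincomb (e y) l).
    by rewrite opprB addrC subrK.
  split.
    by rewrite El; apply: gH.2; [apply: subgroupMz|apply: GH].
  move=> Gl'; apply: nind.
  have Gv : G v.
    by apply: (pG _ N) => //; rewrite -[v *~ N](subrK (lincomb (e y) l)); apply: subgroupD.
  have m0 : m = 0.
    apply: inda; exists (fun i => - n i).
    have -> : lincomb (u y) (fun i => - n i) = - lincomb (u y) n.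
      by rewrite -[RHS]mulrN1z -lincombM; apply: eq_lincomb => i _; rewrite mulrN1.
    by rewrite opprK addrC.
  split=> //; apply: (pure_indep_free gG iu).
  by move: Gv; rewrite /v m0 mulr0z addr0.
pose X := a @` bad.
have /choice[r rP] x : exists y, X x -> bad y /\ a y = x.
  have [[y bady ay]|nX] := pselect (X x); first by exists y.
  have [y [_ _]] := uncountable_setD ncbad (@countable0 _); by exists y.
apply: (@no_runaway_family A G X (u \o r) (p \o r) (w \o r) (Y \o r)) => //.
(* Were [X] countable, uncountably many bad [y] would share one [x] as their [a y]; all of them are
   dependent over [spanned G [:: x]], against [ind]. *)
- move=> cX; have [x ncx] := uncountable_fiber ncbad cX.
  apply: ncx; have := ind (spanned G [:: x]) (subgroup_spanned _ gG)
    (countable_spanned _ gG cG) (@sub_spanned _ _ _).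
  apply: countable_sub => y [bady ay]; split=> // iy.
  have [] := iy (fun=> 0) 1 => //.
  by rewrite lincomb0 add0r ay; apply: mem_spanned => //; rewrite mem_head.
- by move=> x /rP[bad_r ar]; have [_ _ _] := DP _ bad_r; rewrite ar.
- move=> H gH cH GH; have := countable_image a (ind H gH cH GH).
  apply: countable_sub => x [Xx nx]; have [bad_r ar] := rP x Xx.
  by exists (r x) => //; split=> //; rewrite ar.
Qed.

(** * Bases of pure subgroups *)

Section Bases.
Variable A : zmodType.
Implicit Types (e z r l : seq A) (G : set A).

(** An element [x] of finite order [o] can be sent to the class of [1 / o] in Q/Z. A lift to Q
    vanishes at [x], so [1 / o] is an integer and [x = 0]. *)
Lemma lifting_torsion_free : lifting A -> pure [set 0 : A].
Proof.
move=> LA x d d0 xd0; have [|o xo oP] := @int_ideal [set j | x *~ j = 0].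
  split; first by rewrite /= mulr0z.
  by move=> i j /= xi xj; rewrite mulrzBr xi xj subr0.
have {}xo : x *~ o = 0 := xo.
have o0 : o != 0 by apply: contraNneq d0 => o0; rewrite -dvd0z -o0; apply: oP.
have oq0 : o%:~R != 0 :> rat by rewrite intr_eq0.
pose gam := [set v : A * rat | exists k m : int, v = (x *~ k, (k%:~R / o%:~R) + m%:~R)].
have [||f fP] := @lifting_graph A gam LA.
- split; first by exists 0, 0; rewrite mulr0z mul0r addr0.
  move=> _ _ [k [m ->]] [l [n ->]]; exists (k - l), (m - n).
  rewrite mulrzBr !rmorphB mulrBl [LHS]surjective_pairing !raddfB /=.
  by rewrite opprD addrACA.
- move=> q [k [m [/esym/oP/dvdzP[j ->] ->]]].
  by rewrite rmorphM /= mulfK // rpredD // intr_int.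
have fx0 : f x = 0.
  apply/eqP; have := congr1 f xo; rewrite raddf0 raddfMz => /eqP.
  by rewrite mulrz_eq0 (negPf o0).
have /intrP[j] : f x - 1 / o%:~R \is a Num.int.
  by apply: fP; exists 1, 0; rewrite mulr1z addr0.
rewrite fx0 sub0r => /eqP; rewrite eqr_oppLR => /eqP /(congr1 (fun q => q * o%:~R)).
rewrite divfK // mulNr -rmorphM -rmorphN /= => /(@intr_inj rat 1) E.
by rewrite -[x]mulr1z E mulrC -mulrN mulrzA xo mul0rz.
Qed.

Definition independent e : Prop :=
  forall n, lincomb e n = 0 -> forall i, (i < size e)%N -> n i = 0.

Lemma pure_indep0_independent e : pure_indep [set 0] e -> independent e.
Proof. by move=> ie n en; apply: (pure_indep_free (@subgroup_set0 A) ie). Qed.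

Lemma independent_uniq e : independent e -> uniq e.
Proof.
move=> ie; apply/(uniqP 0) => i j; rewrite !inE => lti ltj eij; apply: contrapT => ij.
have := ie (fun k => (i == k)%:Z - (j == k)%:Z).
rewrite lincombB !lincomb_delta // eij subrr => /(_ erefl i lti).
by rewrite eqxx; case: eqP => // /esym.
Qed.

Lemma dual_functional e i : independent e -> (i < size e)%N ->
  exists f : {additive A -> rat}, forall n, f (lincomb e n) = (n i)%:~R.
Proof.
move=> ie lti; pose gam := [set v : A * rat | exists n, v = (lincomb e n, (n i)%:~R)].
have [||f fP] := @additive_extension A _ gam divisible_rat.
- split; first by exists (fun=> 0); rewrite lincomb0.
  move=> _ _ [n ->] [m ->]; exists (fun i => n i - m i).
  by rewrite lincombB rmorphB.
- by move=> q [n [/esym en ->]]; rewrite (ie n).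
by exists f => n; apply: fP; exists n.
Qed.

Lemma dual_basis e : independent e -> exists f : nat -> {additive A -> rat},
  forall i j, (i < size e)%N -> (j < size e)%N -> f i e`_j = (i == j)%:R.
Proof.
move=> ie; suff /choice[f fP] i : exists f : {additive A -> rat}, (i < size e)%N ->
    forall j, (j < size e)%N -> f e`_j = (i == j)%:R.
  by exists f => i j lti; apply: fP.
have [lti|] := ltnP i (size e); last by exists (0 : {additive A -> rat}).
have [f fP] := dual_functional ie lti; exists f => _ j ltj.
by rewrite -lincomb_delta // fP eq_sym; case: eqP.
Qed.

(** The coefficient matrix of [r] over [e], times the matrix of the functionals dual to [r] at [e],
    is the identity. *)
Lemma independent_size r e :
  independent r -> {in r, forall x, int_span e x} -> (size r <= size e)%N.
Proof.
move=> ir re; have [f fP] := dual_basis ir.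
have /choice[n nP] j : exists n : nat -> int, (j < size r)%N -> r`_j = lincomb e n.
  have [ltj|_] := ltnP j (size r); last by exists (fun=> 0).
  by have /int_spanP[n ->] := re _ (mem_nth 0 ltj); exists n.
pose N := \matrix_(j < size r, k < size e) (n j k)%:~R : 'M[rat]_(_, _).
pose F := \matrix_(k < size e, i < size r) f i e`_k.
apply: (@mulmx1_min _ _ _ N F); apply/matrixP => j i; rewrite !mxE.
rewrite -[LHS](_ : f i r`_j = _); first by rewrite fP // eq_sym.
rewrite nP // raddf_lincomb; apply: eq_bigr => k _.
by rewrite !mxE -mulrzr mulrC.
Qed.

Lemma lifting_basis z l : lifting A -> pure_indep [set 0] z ->
  exists u, [/\ pure_indep [set 0] (z ++ u),
    {in u, forall x, hull (int_span (z ++ l)) x} &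
    {in l, forall x, int_span (z ++ u) x}].
Proof.
move=> LA iz; have [u [iu hu]] := pure_indep_or_runaway l
  (@subgroup_set0 A) (lifting_torsion_free LA) iz.
case=> [lu|[a [p [w [Y [_ rY]]]]]]; first by exists u.
by case: (pure0_no_runaway LA rY).
Qed.

Lemma countable_hull G : lifting A -> countable G -> countable (hull G).
Proof.
move=> LA cG; have tf := lifting_torsion_free LA.
have -> : hull G = \bigcup_(x in G) \bigcup_(d in [set d : int | d != 0])
    [set y | y *~ d = x].
  apply/seteqP; split=> [y [d d0 Gy]|y [x Gx [d d0 yx]]].
    by exists (y *~ d) => //; exists d.
  by exists d => //; rewrite yx.
apply: bigcup_countable => // x _; apply: bigcup_countable => // d d0.
have [[y yx]|ny] := pselect (exists y, y *~ d = x).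
  apply: countable_sub (countable1 y) => y' y'x; apply/eqP; rewrite -subr_eq0.
  by apply/eqP/(tf _ d d0); rewrite /= mulrzBl y'x yx subrr.
by apply: countable_sub (@countable0 A) => y yx; apply: ny; exists y.
Qed.

(* Take [r] of maximal size among the independent lists contained in uncountably
   many [int_span (e y)] with [size (e y)] constant. *)
Lemma uncountable_root (P : Type) (S : set P) (e : P -> seq A) :
  ~ countable S -> exists S' r, [/\ S' `<=` S, ~ countable S' &
    forall a, ~ hull (int_span r) a -> countable [set y | S' y /\ int_span (e y) a]].
Proof.
move=> ncS; have [k ncSk] := uncountable_fiber_countType (fun y => size (e y)) ncS.
set S1 := (X in countable X) in ncSk.
pose big r := ~ countable [set y | S1 y /\ {in r, forall x, int_span (e y) x}].
have szr r : independent r -> big r -> (size r <= k)%N.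
  move=> ir bigr; have [y [[[_ <-] ry] _]] := uncountable_setD bigr (@countable0 P).
  exact: independent_size.
have ex0 : exists n, `[< exists r, [/\ independent r, big r & size r = n] >].
  exists 0%N; apply/asboolP; exists [::]; split=> //.
  by apply: contra_not ncSk; apply: countable_sub => y S1y; split.
case: (@ex_maxnP _ k ex0) => [n /asboolP[r [ir bigr <-]]|n]; first exact: szr.
move=> /asboolP[r [ir bigr rn]] nmax.
exists [set y | S1 y /\ {in r, forall x, int_span (e y) x}], r; split=> //.
  by move=> y [[]].
move=> a nra; apply: contrapT => nca.
have /nmax : `[< exists r, [/\ independent r, big r & size r = n.+1] >]; last by rewrite ltnn.
apply/asboolP; exists (rcons r a); rewrite size_rcons rn; split=> //.
  move=> m; rewrite -cats1 lincomb_cat lincomb1 addn0 => E.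
  have m0 : m (size r) = 0.
    apply/eqP/negPn/negP => m0; apply: nra; exists (m (size r)) => //.
    apply/int_spanP; exists (fun i => m i * -1); rewrite lincombM mulrN1z.
    by apply/eqP; rewrite -addr_eq0 addrC E.
  move=> i; rewrite size_cat addn1 ltnS leq_eqVlt => /orP[/eqP -> //|].
  by apply: ir; move: E; rewrite m0 mulr0z addr0.
apply: contra_not nca; apply: countable_sub => y [[S1y ry] ya]; split=> //.
by move=> x; rewrite mem_rcons inE => /orP[/eqP -> //|/ry].
Qed.

(* The basis of [int_span (r ++ z)] meets [G] in a basis of the intersection. *)
Lemma adapted_basis G z l : lifting A -> subgroup G -> pure G ->
  pure_indep G z -> {in l, forall x, spanned G z x} ->
  exists r, [/\ {in r, forall x, G x}, pure_indep [set 0] (r ++ z) &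
    {in l, forall x, int_span (r ++ z) x}].
Proof.
move=> LA gG pG iz lz.
have /choice[n nP] x : exists n, x \in l -> G (x - lincomb z n).
  have [xl|_] := boolP (x \in l); last by exists (fun=> 0).
  by have [n Gx] := lz x xl; exists n.
pose g := [seq x - lincomb z (n x) | x <- l].
have gl : {in g, forall x, G x} by move=> _ /mapP[x xl ->]; apply: nP.
have [r [/= ir hr rg]] := lifting_basis g LA (@pure_indep_nil _ [set 0 : A]).
(* The basis [r] lies in the pure closure of the corrections [g], and [G] is pure. *)
have rG : {in r, forall x, G x}.
  by move=> x /hr; apply: hull_min pG x; apply: int_span_min.
exists r; split=> //.
  apply: pure_indep_cat (@subgroup_set0 A) ir _.
  by apply: pure_indep_sub iz; apply: int_span_min.
move=> x xl; rewrite -[x](subrK (lincomb z (n x))).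
apply: (subgroupD (subgroup_int_span _)).
  by apply/int_span_cat/rg; apply: (map_f (fun x => x - lincomb z (n x))) xl.
apply: (subgroup_lincomb _ (subgroup_int_span _)) => y yz.
by apply: mem_int_span; rewrite mem_cat yz orbT.
Qed.

End Bases.

(** A Löwenheim-Skolem closure: since [op] takes finite arguments, countably many iterations
    suffice. *)
Lemma countable_closure (U : eqType) (op : seq U -> set U) :
  (forall s, countable (op s)) ->
  exists C : set U, countable C /\ forall s, {in s, forall x, C x} -> op s `<=` C.
Proof.
move=> cop; pose next (C : set U) := C `|`
  \bigcup_(s in [set s : seq U | {in s, forall x, C x}]) op s.
pose C i := iter i next set0.
have cC i : countable (C i).
  elim: i => //= i IHi; apply: countableU => //.
  by apply: bigcup_countable => // ; apply: countable_seqs.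
have CS i j : (i <= j)%N -> C i `<=` C j.
  move=> /subnK <-; elim: (j - i)%N => // k IHk x /IHk Ckx.
  by rewrite addSn; left.
exists (\bigcup_i C i); split; first by apply: bigcup_countable.
move=> s sC; suff [i sCi] : exists i, {in s, forall x, C i x}.
  by move=> x sx; exists i.+1 => //; right; exists s.
elim: s sC => [|x s IHs] sC; first by exists 0%N.
have [|i sCi] := IHs; first by move=> y ys; apply: sC; rewrite inE ys orbT.
have [j _ Cjx] := sC x (mem_head _ _); exists (maxn i j) => y.
rewrite inE => /orP[/eqP ->|/sCi]; first exact: CS (leq_maxr _ _) _ _.
exact: CS (leq_maxl _ _) _.
Qed.

(** * Forcing with biadditive approximations *)

Lemma int_subr_mod1 (f f' h h' h1 : rat) : h1 - (h - h') \is a Num.int ->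
  f - h \is a Num.int -> f' - h' \is a Num.int -> f - f' - h1 \is a Num.int.
Proof.
move=> ih i1 i2; have := rpredB (rpredB i1 i2) ih.
have -> : f - h - (f' - h') = f - f' - (h - h') by rewrite !opprD !opprK addrACA.
by rewrite [- (h1 - _)]opprB addrA subrK.
Qed.

Section Biadditive.
Variables A B : zmodType.
Implicit Types (F H : A -> B -> rat) (e : seq A) (d : seq B).

Definition biadditive F : Prop :=
  (forall a a' b, F (a - a') b = F a b - F a' b) /\
  (forall a b b', F a (b - b') = F a b - F a b').

Definition biadditive_mod1 F : Prop :=
  (forall a a' b, F (a - a') b - (F a b - F a' b) \is a Num.int) /\
  (forall a b b', F a (b - b') - (F a b - F a b') \is a Num.int).

Lemma biadditive_span_mod1 F H e d : biadditive F -> biadditive_mod1 H ->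
  {in e & d, forall a b, F a b - H a b \is a Num.int} ->
  forall a b, int_span e a -> int_span d b -> F a b - H a b \is a Num.int.
Proof.
move=> [Fl Fr] [Hl Hr] FH a b ea db.
have int0 (f h : rat) : h - (h - h) \is a Num.int -> f - f - h \is a Num.int.
  by rewrite !subrr subr0 sub0r rpredN.
have Fa b' : b' \in d -> F a b' - H a b' \is a Num.int.
  move=> db'; move: a ea; apply: int_span_min; last by move=> a ae; apply: FH.
  split=> /= [|x y Fx Fy]; last by rewrite Fl; apply: int_subr_mod1 Fx Fy.
  by rewrite -[X in F X _](subrr 0) Fl; apply: int0; have := Hl 0 0 b'; rewrite subrr.
move: b db; apply: int_span_min; last exact: Fa.
split=> /= [|x y Fx Fy]; last by rewrite Fr; apply: int_subr_mod1 Fx Fy.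
by rewrite -[X in F _ X](subrr 0) Fr; apply: int0; have := Hr a 0 0; rewrite subrr.
Qed.

Lemma biadditive_span_eq F F' e d : biadditive F -> biadditive F' ->
  {in e & d, F =2 F'} ->
  forall a b, int_span e a -> int_span d b -> F a b = F' a b.
Proof.
move=> [Fl Fr] [Fl' Fr'] FF' a b ea db.
have Fa b' : b' \in d -> F a b' = F' a b'.
  move=> db'; move: a ea; apply: int_span_min; last by move=> a ae; apply: FF'.
  split=> /= [|x y Fx Fy]; last by rewrite Fl Fl' Fx Fy.
  by rewrite -(subrr (0 : A)) Fl Fl' !subrr.
move: b db; apply: int_span_min; last exact: Fa.
split=> /= [|x y Fx Fy]; last by rewrite Fr Fr' Fx Fy.
by rewrite -(subrr (0 : B)) Fr Fr' !subrr.
Qed.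

(** A sum over products of dual functionals. These are defined on the whole groups because Q is
    divisible, which is why a condition can carry a total map. *)
Lemma biadditive_interpolation e d (V : A -> B -> rat) :
  independent e -> independent d ->
  exists2 F, biadditive F & {in e & d, F =2 V}.
Proof.
move=> ie id; have [f fP] := dual_basis ie; have [g gP] := dual_basis id.
exists (fun a b => \sum_(i < size e) \sum_(j < size d) f i a * g j b * V e`_i d`_j).
  split=> [a a' b|a b b']; rewrite -sumrB; apply: eq_bigr => i _;
    rewrite -sumrB; apply: eq_bigr => j _; rewrite raddfB.
  - by rewrite !mulrBl.
  - by rewrite mulrBr mulrBl.
move=> _ _ /(nthP 0)[i lti <-] /(nthP 0)[j ltj <-].
rewrite (bigD1 (Ordinal lti)) //= [X in _ + X]big1 ?addr0 => [|k ki]; last first.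
  apply: big1 => l _; rewrite fP //.
  by move: ki; rewrite -val_eqE /= => /negPf ->; rewrite !mul0r.
rewrite (bigD1 (Ordinal ltj)) //= big1 ?addr0 => [|k kj]; last first.
  by rewrite gP //; move: kj; rewrite -val_eqE /= => /negPf ->; rewrite mulr0 mul0r.
by rewrite fP // gP // !eqxx !mul1r.
Qed.

End Biadditive.

(** * Forcing conditions, change of basis and amalgamation *)

Section Conditions.
Variables (A B : zmodType) (H : A -> B -> rat).
Hypotheses (LA : lifting A) (LB : lifting B) (bH : biadditive_mod1 H).

(* [F] is a biadditive approximation of the map sought for; only its values on
   the pure subgroups spanned by [e] and [d] are promised. *)
Definition condition_ok (p : seq A * seq B * (A -> B -> rat)) : Prop :=
  let: (e, d, F) := p in
  [/\ pure_indep [set 0] e, pure_indep [set 0] d, biadditive F &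
      {in e & d, forall a b, F a b - H a b \is a Num.int}].

Definition condition : Type := {p | condition_ok p}.
Implicit Types p q r : condition.

Definition lbasis p := (sval p).1.1.
Definition rbasis p := (sval p).1.2.
Definition approx p := (sval p).2.

Lemma conditionP p : [/\ pure_indep [set 0] (lbasis p), pure_indep [set 0] (rbasis p),
  biadditive (approx p) & {in lbasis p & rbasis p, forall a b, approx p a b - H a b \is a Num.int}].
Proof. by case: p => [[[e d] F] ok]. Qed.

Definition cond_le p q : Prop :=
  [/\ {in lbasis p, forall a, int_span (lbasis q) a},
      {in rbasis p, forall b, int_span (rbasis q) b} &
      {in lbasis p & rbasis p, approx p =2 approx q}].

Lemma cond_le_span p q : cond_le p q ->
  forall a b, int_span (lbasis p) a -> int_span (rbasis p) b -> approx p a b = approx q a b.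
Proof.
have [_ _ bp _] := conditionP p; have [_ _ bq _] := conditionP q.
by move=> [_ _ pq]; apply: biadditive_span_eq.
Qed.

Lemma cond_le_refl p : cond_le p p.
Proof. by split=> // x; apply: mem_int_span. Qed.

Lemma cond_le_trans p q r : cond_le p q -> cond_le q r -> cond_le p r.
Proof.
move=> pq qr; have [pq1 pq2 pqF] := pq; have [qr1 qr2 qrF] := qr; split.
- by move=> a /pq1; apply: int_span_min; [exact: subgroup_int_span|].
- by move=> b /pq2; apply: int_span_min; [exact: subgroup_int_span|].
- by move=> a b ap bp; rewrite pqF // (cond_le_span qr) //; [apply: pq1|apply: pq2].
Qed.

Lemma cond_interpolation e d (V : A -> B -> rat) :
  pure_indep [set 0] e -> pure_indep [set 0] d ->
  {in e & d, forall a b, V a b - H a b \is a Num.int} ->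
  exists p, [/\ lbasis p = e, rbasis p = d & {in e & d, approx p =2 V}].
Proof.
move=> ie id VH; have [F bF FV] := biadditive_interpolation V
  (pure_indep0_independent ie) (pure_indep0_independent id).
have ok : condition_ok (e, d, F).
  by split=> // a b ae bd; rewrite FV //; apply: VH.
by exists (exist _ _ ok).
Qed.

(** The bases of [p] are first extended until they span [e] and [d], with [approx p] on the old
    pairs and [H] on the new ones. The resulting map is congruent to [H] on the spans, so it may be
    kept while the bases are replaced by [e] and [d]. *)
Lemma cond_rebase p e d : pure_indep [set 0] e -> pure_indep [set 0] d ->
  {in lbasis p, forall a, int_span e a} -> {in rbasis p, forall b, int_span d b} ->
  exists q, [/\ cond_le p q, lbasis q = e & rbasis q = d].
Proof.
move=> ie id pe pd; have [ip1 ip2 bp pH] := conditionP p.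
have [u [iu _ eu]] := lifting_basis e LA ip1.
have [t [it _ dt]] := lifting_basis d LB ip2.
pose V a b := if (a \in lbasis p) && (b \in rbasis p) then approx p a b else H a b.
have [|q [qe qd qV]] := @cond_interpolation _ _ V iu it.
  move=> a b _ _; rewrite /V; case: andP => [[ap bp']|_]; first exact: pH.
  by rewrite subrr rpred0.
have [_ _ bq qH] := conditionP q.
have ok : condition_ok (e, d, approx q).
  split=> // a b ae bd; apply: (biadditive_span_mod1 bq bH qH).
    by rewrite qe; apply: eu.
  by rewrite qd; apply: dt.
exists (exist _ _ ok); split=> //; split=> // a b ap bp'.
by rewrite [RHS]qV ?mem_cat ?ap ?bp' // /V ap bp'.
Qed.

(** Values on pairs from the joint bases are free, and an independent list has no repetitions. A
    pair that both conditions decide therefore comes from [r] and [r'], where they agree; undecided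
    pairs receive [H]. *)
Lemma cond_amalgam p q (r u z : seq A) (r' u' z' : seq B) :
  lbasis p = r ++ u -> rbasis p = r' ++ u' ->
  lbasis q = r ++ z -> rbasis q = r' ++ z' ->
  {in r & r', approx p =2 approx q} ->
  pure_indep [set 0] ((r ++ u) ++ z) -> pure_indep [set 0] ((r' ++ u') ++ z') ->
  exists s, cond_le p s /\ cond_le q s.
Proof.
move=> pe pd qe qd pq ie id.
have [_ _ _ pH] := conditionP p; have [_ _ _ qH] := conditionP q.
pose V a b := if (a \in lbasis p) && (b \in rbasis p) then approx p a b
  else if (a \in lbasis q) && (b \in rbasis q) then approx q a b else H a b.
have [|s [se sd sV]] := @cond_interpolation _ _ V ie id.
  move=> a b _ _; rewrite /V; case: andP => [[ap bp]|_]; first exact: pH.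
  case: andP => [[aq bq]|_]; first exact: qH.
  by rewrite subrr rpred0.
have disjoint (T : zmodType) (x : T) (r0 u0 z0 : seq T) : pure_indep [set 0] ((r0 ++ u0) ++ z0) ->
    x \in r0 ++ u0 -> x \in r0 ++ z0 -> x \in r0.
  move=> /pure_indep0_independent/independent_uniq; rewrite cat_uniq.
  move=> /and3P[_ /hasPn/(_ x) nx _] xru; rewrite mem_cat => /orP[//|/nx].
  by rewrite xru.
exists s; split; split.
- by move=> a; rewrite pe se => ap; apply: mem_int_span; rewrite mem_cat ap.
- by move=> b; rewrite pd sd => bp; apply: mem_int_span; rewrite mem_cat bp.
- move=> a b ap bp; rewrite sV; first by rewrite /V ap bp.
    by rewrite mem_cat -pe ap.
  by rewrite mem_cat -pd bp.
- move=> a; rewrite qe se => aq; apply: mem_int_span; move: aq.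
  by rewrite !mem_cat => /orP[] ->; rewrite ?orbT.
- move=> b; rewrite qd sd => bq; apply: mem_int_span; move: bq.
  by rewrite !mem_cat => /orP[] ->; rewrite ?orbT.
- move=> a b aq bq; rewrite sV; first last.
  + by move: bq; rewrite qd !mem_cat => /orP[] ->; rewrite ?orbT.
  + by move: aq; rewrite qe !mem_cat => /orP[] ->; rewrite ?orbT.
  rewrite /V; case: andP => [[ap bp]|_]; last by rewrite aq bq.
  apply/esym/pq; [apply: disjoint ie _ _|apply: disjoint id _ _].
  + by rewrite -pe.
  + by rewrite -qe.
  + by rewrite -pd.
  + by rewrite -qd.
Qed.

End Conditions.

(** * Chain condition, density and the generic biadditive map *)

Section Forcing.
Variables (A B : zmodType) (H : A -> B -> rat).
Hypotheses (MA : martin_axiom).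
Hypotheses (ltA : card_lt [set: A] continuum) (ltB : card_lt [set: B] continuum).
Hypotheses (LA : lifting A) (LB : lifting B) (bH : biadditive_mod1 H).

Let cond := condition H.
Implicit Types (p q x y : cond).

Let lefts (s : seq (A + B)) : seq A :=
  pmap (fun c => if c is inl a then Some a else None) s.

Let rights (s : seq (A + B)) : seq B :=
  pmap (fun c => if c is inr b then Some b else None) s.

Let lefts_cat r r' : lefts (map inl r ++ map inr r') = r.
Proof.
rewrite /lefts pmap_cat; elim: r => /= [|a r -> //].
by elim: r'.
Qed.

Let rights_cat r r' : rights (map inl r ++ map inr r') = r'.
Proof.
rewrite /rights pmap_cat; elim: r => //=.
by elim: r' => //= b r' ->.
Qed.

(* Given a closed countable pair [(G, K)] and a condition [y] outside, the trace
   of [y] on [(G, K)] is also realized by a condition [x] inside, and then [x]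
   and [y] can be amalgamated. *)
Lemma condition_ccc (S : set cond) : ~ countable S ->
  exists p q r, [/\ S p, S q, p <> q, cond_le p r & cond_le q r].
Proof.
move=> ncS.
have [S1 [rA [S1S ncS1 rootA]]] := uncountable_root (@lbasis _ _ H) ncS.
have [S2 [rB [S21 ncS2 rootB]]] := uncountable_root (@rbasis _ _ H) ncS1.
pose vals p r r' := [seq approx p c.1 c.2 | c <- [seq (a, b) | a <- r, b <- r']].
(* A key is a finite trace: two roots and the values on their pairs. The first component belongs to
   the family; the second is an extension whose bases begin with the roots. *)
pose realizes (k : seq A * seq B * seq rat) (xx : cond * cond) :=
  [/\ S2 xx.1, cond_le xx.1 xx.2 & exists u u', [/\ lbasis xx.2 = k.1.1 ++ u,
    rbasis xx.2 = k.1.2 ++ u' & vals xx.2 k.1.1 k.1.2 = k.2]].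
have [y0 _] := uncountable_setD ncS (@countable0 _).
have /choice[sel selP] k : exists xx, (exists yy, realizes k yy) -> realizes k xx.
  have [[yy ky]|nk] := pselect (exists yy, realizes k yy); first by exists yy.
  by exists (y0, y0).
(* Elements of both groups are coded in one sum type so that a single closure serves both sides.
   Closing under hulls with [rA] and [rB] makes [G] and [K] pure and puts the roots of the family
   inside; the rest puts inside the bases of the conditions selected for every trace. *)
pose op (s : seq (A + B)) : set (A + B) :=
  (inl @` hull (int_span (lefts s ++ rA)) `|` inr @` hull (int_span (rights s ++ rB))) `|`
  \bigcup_(v in [set: seq rat])
    ([set` [seq inl a | a <- lbasis (sel (lefts s, rights s, v)).2]] `|`
     [set` [seq inr b | b <- rbasis (sel (lefts s, rights s, v)).2]]).
have [C [cC opC]] : exists C : set (A + B), countable C /\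
    forall s, {in s, forall c, C c} -> op s `<=` C.
  apply: countable_closure => s; apply: countableU.
    by apply: countableU; apply/countable_image/countable_hull/countable_int_span.
  apply: bigcup_countable => // v _.
  by apply: countableU; apply/finite_set_countable/finite_seq.
pose G := [set a | C (inl a)]; pose K := [set b | C (inr b)].
have opG s : {in s, forall c, C c} -> hull (int_span (lefts s ++ rA)) `<=` G.
  by move=> /opC sC a sa; apply: sC; left; left; exists a.
have opK s : {in s, forall c, C c} -> hull (int_span (rights s ++ rB)) `<=` K.
  by move=> /opC sC b sb; apply: sC; left; right; exists b.
have /pcard_injP[f injf] := cC.
have cG : countable G.
  apply/pcard_injP; exists (fun a => f (inl a)) => a a'; rewrite !inE => Ga Ga'.
  by move=> /injf; rewrite !inE => /(_ Ga Ga') [].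
have cK : countable K.
  apply/pcard_injP; exists (fun b => f (inr b)) => b b'; rewrite !inE => Kb Kb'.
  by move=> /injf; rewrite !inE => /(_ Kb Kb') [].
have gG : subgroup G.
  split; first by apply: (opG [::]) => //; apply: sub_hull; case: (subgroup_int_span rA).
  move=> a a' Ga Ga'; apply: (opG [:: inl a; inl a']).
    by move=> c; rewrite !inE => /orP[] /eqP ->.
  by apply/sub_hull/(subgroup_int_span _).2; apply: mem_int_span; rewrite !inE eqxx ?orbT.
have gK : subgroup K.
  split; first by apply: (opK [::]) => //; apply: sub_hull; case: (subgroup_int_span rB).
  move=> b b' Kb Kb'; apply: (opK [:: inr b; inr b']).
    by move=> c; rewrite !inE => /orP[] /eqP ->.
  by apply/sub_hull/(subgroup_int_span _).2; apply: mem_int_span; rewrite !inE eqxx ?orbT.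
have pG : pure G.
  move=> a d d0 Ga; apply: (opG [:: inl (a *~ d)]).
    by move=> c; rewrite inE => /eqP ->.
  by exists d => //; apply: mem_int_span; rewrite mem_head.
have pK : pure K.
  move=> b d d0 Kb; apply: (opK [:: inr (b *~ d)]).
    by move=> c; rewrite inE => /eqP ->.
  by exists d => //; apply: mem_int_span; rewrite mem_head.
have rootG a : ~ G a -> countable [set y | S2 y /\ int_span (lbasis y) a].
  move=> nGa; apply: countable_sub (rootA a _) => [y [/S21]|ha] //.
  by apply: nGa; apply: (opG [::]).
have rootK b : ~ K b -> countable [set y | S2 y /\ int_span (rbasis y) b].
  move=> nKb; apply: countable_sub (rootB b _) => [y []|hb] //.
  by apply: nKb; apply: (opK [::]).
pose keys := [set k : seq A * seq B * seq rat |
  {in k.1.1, forall a, G a} /\ {in k.1.2, forall b, K b}].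
have ckeys : countable keys.
  have := countableX (countableX (countable_seqs cG) (countable_seqs cK))
    (countableP [set: seq rat]).
  by apply: countable_sub => -[[r r'] v] [/= Gr Kr'].
(* Outside the exceptional sets of [countable_runaway] for [A] and [B], [y] has finite bases modulo
   [G] and [K]. Avoiding the selected conditions makes [y] differ from the one that will realize its
   trace. *)
have [y [S2y]] := uncountable_setD ncS2 (countableU (countableU
  (countable_runaway MA ltA LA gG cG pG rootG)
  (countable_runaway MA ltB LB gK cK pK rootK))
  (countable_image (fun k => (sel k).1) ckeys)).
move=> /not_orP[/not_orP[/not_andP[//|/contrapT[z iz yz]]]].
move=> /not_andP[//|/contrapT[z' iz' yz']] nsel.
have [r [rG irz rzy]] := adapted_basis LA gG pG iz yz.
have [r' [rK irz' rzy']] := adapted_basis LB gK pK iz' yz'.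
have [y' [yy' y'e y'd]] := cond_rebase LA LB bH irz irz' rzy rzy'.
pose k := (r, r', vals y' r r').
have [S2x xx' [u [u' [x'e x'd x'v]]]] : realizes k (sel k).
  by apply: selP; exists (y, y'); split=> //; exists z, z'.
have sC : {in map inl r ++ map inr r', forall c, C c}.
  by move=> c; rewrite mem_cat => /orP[] /mapP[? ? ->]; [apply: rG|apply: rK].
have x'G : int_span (r ++ u) `<=` G.
  apply: int_span_min gG _ => a; rewrite -x'e => ax; apply: (opC _ sC).
  right; exists (vals y' r r') => //; left; rewrite lefts_cat rights_cat.
  exact: map_f ax.
have x'K : int_span (r' ++ u') `<=` K.
  apply: int_span_min gK _ => b; rewrite -x'd => bx; apply: (opC _ sC).
  right; exists (vals y' r r') => //; right; rewrite lefts_cat rights_cat.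
  exact: map_f bx.
have [ix' ix'' _ _] := conditionP (sel k).2.
have [|||s [x's y's]] := cond_amalgam x'e x'd y'e y'd.
- move=> a b ar br; have /eq_in_map := x'v.
  by move=> /(_ (a, b)); apply; apply: allpairs_f.
- rewrite x'e in ix'; apply: pure_indep_cat (@subgroup_set0 A) ix' _.
  exact: pure_indep_sub iz.
- rewrite x'd in ix''; apply: pure_indep_cat (@subgroup_set0 B) ix'' _.
  exact: pure_indep_sub iz'.
exists (sel k).1, y, s; split.
- exact/S1S/S21.
- exact/S1S/S21.
- by move=> E; apply: nsel; exists k.
- exact: cond_le_trans xx' x's.
- exact: cond_le_trans yy' y's.
Qed.

Lemma cond_dense_left a p : exists q, cond_le p q /\ int_span (lbasis q) a.
Proof.
have [ie id _ _] := conditionP p; have [u [iu _ au]] := lifting_basis [:: a] LA ie.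
have [||q [pq qe _]] := cond_rebase LA LB bH iu id (p := p).
- by move=> x xp; apply: mem_int_span; rewrite mem_cat xp.
- by move=> x; apply: mem_int_span.
by exists q; rewrite qe; split=> //; apply/au/mem_head.
Qed.

Lemma cond_dense_right b p : exists q, cond_le p q /\ int_span (rbasis q) b.
Proof.
have [ie id _ _] := conditionP p; have [u [iu _ bu]] := lifting_basis [:: b] LB id.
have [||q [pq _ qd]] := cond_rebase LA LB bH ie iu (p := p).
- by move=> x; apply: mem_int_span.
- by move=> x xp; apply: mem_int_span; rewrite mem_cat xp.
by exists q; rewrite qd; split=> //; apply/bu/mem_head.
Qed.

Lemma biadditive_lifting :
  exists2 F, biadditive F & forall a b, F a b - H a b \is a Num.int.
Proof.
pose D (c : A + B) : set cond := match c with
  | inl a => [set p | int_span (lbasis p) a]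
  | inr b => [set p | int_span (rbasis p) b] end.
have [||||||G [dirG meetG]] := martin_axiom_preorder (D := D) (le := @cond_le _ _ H) MA.
- have [|p _] := @cond_interpolation A B H [::] [::] H (@pure_indep_nil _ _) (@pure_indep_nil _ _).
    by [].
  by exists p.
- exact: cond_le_refl.
- exact: cond_le_trans.
- exact: condition_ccc.
- exact: card_lt_continuum_sum.
- by case=> [a|b] p; [have [q []] := cond_dense_left a p|have [q []] := cond_dense_right b p];
    exists q.
have spanl p q : cond_le p q -> int_span (lbasis p) `<=` int_span (lbasis q).
  by case=> pq _ _; apply: int_span_min => //; apply: subgroup_int_span.
have spanr p q : cond_le p q -> int_span (rbasis p) `<=` int_span (rbasis q).
  by case=> _ pq _; apply: int_span_min => //; apply: subgroup_int_span.
pose covers p a b := int_span (lbasis p) a /\ int_span (rbasis p) b.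
have coverG a b : exists2 p, G p & covers p a b.
  have [p Gp pa] := meetG (inl a); have [q Gq qb] := meetG (inr b).
  have [r [Gr pr qr]] := dirG _ _ Gp Gq.
  by exists r => //; split; [apply: spanl pr _ pa|apply: spanr qr _ qb].
have cover_le p q a b : cond_le p q -> covers p a b -> covers q a b.
  by move=> pq [pa pb]; split; [apply: spanl pq _ pa|apply: spanr pq _ pb].
have /choice[f fP] (c : A * B) : exists t, exists2 p, G p &
    covers p c.1 c.2 /\ t = approx p c.1 c.2.
  by have [p Gp pc] := coverG c.1 c.2; exists (approx p c.1 c.2), p.
(* Directedness makes the value independent of the chosen condition: a common extension agrees with
   both on their spans. *)
have fE p a b : G p -> covers p a b -> f (a, b) = approx p a b.
  move=> Gp [pa pb]; have [q Gq [[qa qb] ->]] := fP (a, b).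
  have [r [_ qr pr]] := dirG _ _ Gq Gp.
  by rewrite (cond_le_span qr qa qb) (cond_le_span pr pa pb).
have common a b a' b' : exists2 p, G p & covers p a b /\ covers p a' b'.
  have [p Gp pab] := coverG a b; have [q Gq qab] := coverG a' b'.
  have [r [Gr pr qr]] := dirG _ _ Gp Gq.
  by exists r => //; split; [apply: cover_le pab|apply: cover_le qab].
exists (fun a b => f (a, b)).
  split=> [a a' b|a b b'].
    have [p Gp [pa pa']] := common a b a' b; have [_ _ [bl _] _] := conditionP p.
    rewrite !(fE p) //; case: pa pa' => pa pb [pa' _]; split=> //.
    exact: (subgroup_int_span _).2.
  have [p Gp [pb pb']] := common a b a b'; have [_ _ [_ br] _] := conditionP p.
  rewrite !(fE p) //; case: pb pb' => pa pb [_ pb']; split=> //.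
  exact: (subgroup_int_span _).2.
move=> a b; have [p Gp [pa pb]] := coverG a b; have [_ _ bp pH] := conditionP p.
by rewrite (fE p) //; apply: biadditive_span_mod1 bp bH pH _ _ pa pb.
Qed.

End Forcing.

(** * Ext and lifting *)

Section ExtLifting.
Variable A : zmodType.

Lemma freeg_generated (S : set {freeg A}) :
  subgroup S -> (forall a, S << a >>) -> forall x, S x.
Proof.
move=> gS Sa x; rewrite -[x]freeg_sumE.
elim: (dom x) => [|z s IHs]; first by rewrite big_nil; case: gS.
rewrite big_cons; apply: subgroupD => //.
have -> : << coeff z x *g z >> = << z >> *~ coeff z x by rewrite freegU_mulz intz.
exact: subgroupMz.
Qed.

Lemma freeg_lift (C : zmodType) (t : A -> C) :
  exists f : {additive {freeg A} -> C}, forall a, f << a >> = t a.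
Proof.
pose f : {freeg A} -> C := fglift (t : A -> zmodule C).
have [x y|g gE] := @exists_additive _ _ f.
  exact: (@lift_is_additive int A (zmodule C) t x y).
by exists g => a; rewrite gE /f liftU scale1r.
Qed.

Lemma augmentationU (a : A) : augmentation << a >> = a.
Proof. by rewrite /augmentation liftU scale1r. Qed.

Lemma relationP (x : {freeg A}) : augmentation x = 0 ->
  exists r : relations A, val r = x.
Proof.
move=> x0; have xr : x \in relation_pred (A := A) by rewrite unfold_in /relation_pred x0.
by exists (Relation xr).
Qed.

Lemma relation_aug (r : relations A) : augmentation (val r) = 0.
Proof. by have := valP r; rewrite unfold_in /relation_pred => /eqP. Qed.

Lemma trivial_ExtP (C : zmodType) :
  trivial_group (Ext A C) <->
  forall g : {additive relations A -> C}, exists f, g = restrict_relations f.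
Proof.
pose I : zmodClosed {additive relations A -> C} :=
  GRing.ZmodClosed.clone {additive relations A -> C} (@restrictable A C) _.
split=> E => [g|x].
  have : g - 0 \in I.
    by rewrite Quotient.idealrBE; apply/eqP; exact: (etrans (E _) (esym (E _))).
  by rewrite subr0 => /asboolP.
have : repr x - repr (0 : Ext A C) \in I by apply/asboolP/E.
by rewrite Quotient.idealrBE !reprK => /eqP.
Qed.

(** The extension [phi] of [h] to the free group is integral on relations, hence agrees there with
    some integral [f] on the whole free group. The difference of [phi] and [f] kills the relations
    and descends to the lift. *)
Lemma trivial_Ext_lifting : trivial_group (Ext A int) -> lifting A.
Proof.
move=> /trivial_ExtP E h hD.
have [phi phiE] := freeg_lift h.
have h0 : h 0 \is a Num.int.
  by have := hD 0 0; rewrite addr0 subrr sub0r rpredN.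
have hB x y : h (x - y) - (h x - h y) \is a Num.int.
  have := hD (x - y) y; rewrite subrK -rpredN; congr (_ \is a Num.int).
  by rewrite !opprB addrCA.
have phi_h x : phi x - h (augmentation x) \is a Num.int.
  move: x; apply: freeg_generated => /= [|a]; last first.
    by rewrite phiE augmentationU subrr rpred0.
  split=> /= [|x y ix iy]; first by rewrite !raddf0 sub0r rpredN.
  by rewrite !raddfB /=; apply: int_subr_mod1 ix iy; apply: hB.
have /choice[n nP] (r : relations A) : exists n : int, phi (val r) = n%:~R.
  have := phi_h (val r); rewrite relation_aug => ir.
  by have /intrP[n En] := rpredD ir h0; exists n; apply: etrans En; rewrite subrK.
have [r s|g gE] := @exists_additive _ _ n.
  by apply/(@intr_inj rat); rewrite rmorphB /= -!nP !raddfB.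
have [f gf] := E g.
have fphi (r : relations A) : phi (val r) = (f (val r))%:~R.
  by rewrite nP -gE gf.
pose F a := h a - (f << a >>)%:~R.
have [x y|F' F'E] := @exists_additive _ _ F.
  have [|r rE] := @relationP (<< x - y >> - (<< x >> - << y >>)).
    by rewrite !raddfB /= !augmentationU -opprD subrr.
  have := fphi r; rewrite rE !(raddfB phi) !(raddfB f) /= !phiE => /eqP; rewrite subr_eq => /eqP E'.
  rewrite /F E' rmorphB /= rmorphB [LHS]addrC -[X in _ + X = _]addrA addKr.
  by rewrite [LHS]addrC !opprD !opprK addrACA.
by exists F' => a; rewrite F'E /F addrAC subrr sub0r rpredN intr_int.
Qed.

(** Since Hom(B, Q) is divisible, [g] extends to [phi] on the free group with values there. On
    generators [phi] is biadditive modulo Z, and subtracting [F] makes it integral without changing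
    it on relations, because [F] factors through the augmentation. *)
Lemma trivial_Ext_dual (B : zmodType) :
  (forall H : A -> B -> rat, biadditive_mod1 H ->
    exists2 F, biadditive F & forall a b, F a b - H a b \is a Num.int) ->
  trivial_group (Ext A (dual_group B)).
Proof.
move=> lift; apply/trivial_ExtP => g.
have divD : divisible {additive B -> rat}.
  move=> f k k0; have [x y|e eE] := @exists_additive _ _ (fun b => f b / k%:~R).
    by rewrite raddfB mulrBl.
  have evM b : (e *~ k) b = e b *~ k.
    have [//|v vE] := @exists_additive _ _ (fun f : {additive B -> rat} => f b).
    by rewrite -!vE raddfMz.
  by exists e; apply: homP => b; rewrite evM eE -mulrzr divfK // intr_eq0.
pose gam := [set v : {freeg A} * {additive B -> rat} | exists r : relations A,
  v.1 = val r /\ forall b, v.2 b = (g r b)%:~R].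
have [||phi phiP] := additive_extension divD (gam := gam).
- split; first by exists 0; split=> [|b]; rewrite ?(raddf0 g) ?raddf0.
  move=> x y [r [xr rE]] [s [ys sE]]; exists (r - s).
  rewrite !raddfB /= xr ys; split=> // b.
  by rewrite rmorphB /= -rE -sE.
- move=> f [r [r0 fE]]; apply: homP => b; rewrite fE.
  have -> : r = 0 by apply: val_inj; rewrite -r0.
  by rewrite raddf0.
have phi_g (r : relations A) b : phi (val r) b = (g r b)%:~R.
  have [x y|e eE] := @exists_additive _ _ (fun b => (g r b)%:~R : rat).
    by rewrite raddfB rmorphB.
  by rewrite (phiP _ e) ?eE //; exists r.
pose H a b := phi << a >> b.
have bH : biadditive_mod1 H.
  split=> [a a' b|a b b']; last by rewrite /H raddfB subrr rpred0.
  have [|r rE] := @relationP (<< a - a' >> - (<< a >> - << a' >>)).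
    by rewrite !raddfB /= !augmentationU -opprD subrr.
  by have := phi_g r b; rewrite rE !raddfB /= => ->; rewrite intr_int.
have [F [Fl Fr] FH] := lift H bH.
have /choice[t tE] a : exists t : {additive B -> int}, forall b, (t b)%:~R = H a b - F a b.
  have /choice[n nE] b : exists n : int, n%:~R = H a b - F a b.
    have := FH a b; rewrite -rpredN opprB => /intrP[n En]; by exists n.
  have [x y|n' n'E] := @exists_additive _ _ n.
    apply/(@intr_inj rat); rewrite rmorphB /= !nE /H raddfB Fr.
    by rewrite !opprD !opprK addrACA.
  by exists n' => b; rewrite n'E nE.
have [f fE] := @freeg_lift (dual_group B) t.
have F0 b : F 0 b = 0 by rewrite -(subrr 0) Fl subrr.
have fphi x b : (f x b)%:~R = phi x b - F (augmentation x) b.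
  move: x; apply: freeg_generated => [|a] /=; last by rewrite fE tE augmentationU.
  split=> /= [|x y xE yE]; first by rewrite !raddf0 F0 subr0.
  have -> : f (x - y) b = f x b - f y b by rewrite (raddfB f).
  have -> : phi (x - y) b = phi x b - phi y b by rewrite (raddfB phi).
  rewrite (raddfB (@augmentation A)) Fl rmorphB /= xE yE.
  by rewrite !opprD !opprK addrACA.
exists f; apply: homP => r; apply: homP => b; apply: (@intr_inj rat).
by rewrite /= fphi relation_aug F0 subr0 phi_g.
Qed.

End ExtLifting.

Unset Implicit Arguments.

Theorem theorem4p1 (MA : martin_axiom) (notCH : card_lt aleph1 continuum)
    (A B : zmodType)
    (cardA : [set: A] #<= aleph1) (cardB : [set: B] #<= aleph1)
    (extA : trivial_group (Ext A int)) (extB : trivial_group (Ext B int)) :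
  trivial_group (Ext A (dual_group B)).
Proof.
have lt_continuum (C : zmodType) : [set: C] #<= aleph1 -> card_lt [set: C] continuum.
  have [le nle] := notCH => leC; split; first exact: card_le_trans leC le.
  by move=> geC; apply: nle; apply: card_le_trans geC leC.
apply: trivial_Ext_dual => H bH.
apply: (biadditive_lifting MA _ _ _ _ bH); do ?exact: lt_continuum.
  exact: trivial_Ext_lifting.
exact: trivial_Ext_lifting.
Qed.
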